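(* Let $n\in\mathbb N$, let $H_S\in\mathbb C^{n\times n}$ be Hermitian, and let $T\in(0,\infty]$. Let $\mathsf{TO}(H_S,T)$ be the set of thermal operations defined in the context, and let $\overline{(\cdot)}$ denote the closure in $\mathcal L(\mathbb C^{n\times n})$. The following statements hold: (i) $\mathsf{TO}(H_S,T)$ is a bounded, path-connected semigroup (under composition) with identity. (ii) $\overline{\mathsf{TO}(H_S,T)}$ is a convex, compact semigroup (under composition) with identity. (iii) $\overline{\mathsf{TO}(H_S,T)}$ is a subset of the set of all completely positive trace-preserving linear maps on $\mathbb C^{n\times n}$ which have $e^{-H_S/T}$ as a fixed point (where $e^{-H_S/T}:=\mathbb 1_n$ if $T=\infty$). (iv) $\overline{\mathsf{TO}(H_S,T)}$ equals the closure of the set of all maps $\Phi_{T,m}(H_B,e^{iH_{\mathrm{tot}}})$ where $m$ ranges over $\mathbb N$, $H_B=\operatorname{diag}(E_1',\ldots,E_m')$ with real $E_1'\le\ldots\le E_m'$ has resonant spectrum with respect to $H_S$, and $H_{\mathrm{tot}}\in\mathbb C^{mn\times mn}$ is Hermitian with $[H_{\mathrm{tot}},H_S\otimes\mathbb 1_m+\mathbb 1_n\otimes H_B]=0$.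
   Context: $\mathcal L(\mathbb C^{n\times n})$ is the (finite-dimensional) space of linear maps $\mathbb C^{n\times n}\to\mathbb C^{n\times n}$. For $m\in\mathbb N$, $H_B\in\mathbb C^{m\times m}$ Hermitian, $U\in\mathbb C^{mn\times mn}$ unitary and $T\in(0,\infty)$ define $$\Phi_{T,m}(H_B,U)(X):=\operatorname{tr}_B\Big(U\Big(X\otimes\frac{e^{-H_B/T}}{\operatorname{tr}(e^{-H_B/T})}\Big)U^*\Big),\qquad X\in\mathbb C^{n\times n},$$ where $\operatorname{tr}_B$ is the partial trace over the second tensor factor $\mathbb C^m$ of $\mathbb C^n\otimes\mathbb C^m$. For $T=\infty$ the Gibbs state is replaced by the maximally mixed state: $\Phi_{\infty,m}(H_B,U)(X):=\operatorname{tr}_B(U(X\otimes\frac{1}{m}\mathbb 1_m)U^* )$. Thermal operations: $\mathsf{TO}(H_S,T)$ is the set of all maps $\Phi_{T,m}(H_B,U)$ with $m\in\mathbb N$, $H_B\in\mathbb C^{m\times m}$ Hermitian, and $U\in\mathbb C^{mn\times mn}$ unitary satisfying energy conservation $U(H_S\otimes\mathbb 1_m+\mathbb 1_n\otimes H_B)U^*=H_S\otimes\mathbb 1_m+\mathbb 1_n\otimes H_B$ (this condition, involving $H_B$, is also imposed for $T=\infty$). Resonant spectrum: let $\sigma(\operatorname{ad}_{H_S})=\{E_i-E_j: E_i,E_j\in\sigma(H_S)\}$ be the spectrum of $\operatorname{ad}_{H_S}=[H_S,\cdot\,]$. Given Hermitian $H_B$ consider the undirected graph whose vertices are the eigenvalues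 of $H_B$, two vertices being joined iff the difference of the corresponding eigenvalues lies in $\sigma(\operatorname{ad}_{H_S})$. $H_B$ has resonant spectrum with respect to $H_S$ if this graph is connected. *)

(* Defs.v *)
(* MathComp / MathComp-Analysis; the complex numbers are R[i] for R : realType. *)
From HB Require Import structures.
From mathcomp Require Import all_boot all_order all_algebra.
From mathcomp Require Import all_classical all_reals all_analysis.
From mathcomp Require Import complex mxtens.

Set Implicit Arguments.
Unset Strict Implicit.
Unset Printing Implicit Defensive.

Import Order.TTheory GRing.Theory Num.Theory.
Import numFieldNormedType.Exports.

Local Open Scope classical_set_scope.
Local Open Scope ring_scope.
Local Open Scope sesquilinear_scope.

HB.instance Definition _ (R : realType) := NormedModule.copy R[i] R[i]^o.

(* The normed space of linear maps on n x n complex matrices. The norm is the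
   maximum norm of the representing matrix; all norms on this
   finite-dimensional space induce the same topology and bounded sets. *)
Section SuperoperatorNorm.
Variables (R : realType) (n : nat).
Implicit Types f g : 'End('M[R[i]]_n).

Definition superop_norm f : R[i] := `| lin_mx f |.

Lemma superop_normD f g :
  superop_norm (f + g) <= superop_norm f + superop_norm g.
Proof.
rewrite /superop_norm; have -> : lin_mx (f + g) = lin_mx f + lin_mx g.
  apply/row_matrixP => i; rewrite linearD/= !rowE !mul_rV_lin -linearD/=.
  by congr mxvec; exact: add_lfunE.
exact: ler_normD.
Qed.

Lemma superop_normZ (c : R[i]) f :
  superop_norm (c *: f) = `|c| * superop_norm f.
Proof.
rewrite /superop_norm; have -> : lin_mx (c *: f) = c *: lin_mx f.
  apply/row_matrixP => i; rewrite linearZ/= !rowE !mul_rV_lin -linearZ/=.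
  by congr mxvec; exact: scale_lfunE.
exact: normrZ.
Qed.

Lemma superop_norm0_eq0 f : superop_norm f = 0 -> f = 0.
Proof.
move=> /normr0_eq0 f0; apply/lfunP => X; rewrite lfunE/=.
by rewrite -[f X]mxvecK -mul_vec_lin f0 mulmx0 linear0.
Qed.

HB.instance Definition _ :=
  Lmodule_isNormed.Build R[i] 'End('M[R[i]]_n)
    superop_normD superop_normZ superop_norm0_eq0.

End SuperoperatorNorm.

Definition semigroup_with_id (R : realType) (n : nat)
    (S : set 'End('M[R[i]]_n)) : Prop :=
  S \1%VF /\ forall f g, S f -> S g -> S (f \o g)%VF.

Definition path_connected (R : realType) (V : topologicalType)
    (A : set V) : Prop :=
  forall x y, A x -> A y -> exists gamma : R -> V,
    [/\ {within `[0, 1], continuous gamma}, gamma 0 = x, gamma 1 = y &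
        forall t, 0 <= t <= 1 -> A (gamma t)].

Definition expmx (R : realType) (n : nat) (A : 'M[R[i]]_n) : 'M[R[i]]_n :=
  limn (series (fun k => (k`!%:R)^-1 *: A ^+ k)).

(* e^{-H/T}, read as the identity at T = +oo. The value at T = -oo is a dummy:
   temperatures are positive. *)
Definition boltzmann (R : realType) (n : nat) (T : \bar R) (H : 'M[R[i]]_n) :
    'M[R[i]]_n :=
  match T with
  | t%:E => expmx (- (t^-1)%:C%C *: H)
  | _ => 1%:M
  end.

(* The bath state: the Gibbs state, or the maximally mixed state at T = +oo. *)
Definition bath_state (R : realType) (m : nat) (T : \bar R) (H : 'M[R[i]]_m) :
    'M[R[i]]_m :=
  match T with
  | _%:E => (\tr (boltzmann T H))^-1 *: boltzmann T H
  | _ => m%:R^-1 *: 1%:M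
  end.

Definition ptraceB (R : realType) (n m : nat) (X : 'M[R[i]]_(n * m)) :
    'M[R[i]]_n :=
  \matrix_(i, j) \sum_(k < m) X (mxtens_index (i, k)) (mxtens_index (j, k)).

Section ThermalMap.
Variables (R : realType) (n m : nat) (T : \bar R).
Variables (HB : 'M[R[i]]_m) (U : 'M[R[i]]_(n * m)).

Definition thermal_fun (X : 'M[R[i]]_n) : 'M[R[i]]_n :=
  ptraceB (U *m (X *t bath_state T HB) *m U ^t*).

Lemma thermal_fun_linear : linear thermal_fun.
Proof.
move=> c X Y; rewrite /thermal_fun.
have -> : (c *: X + Y) *t bath_state T HB
    = c *: (X *t bath_state T HB) + Y *t bath_state T HB.
  by apply/matrixP => i j; rewrite !mxE mulrDl mulrA.
rewrite mulmxDr mulmxDl -scalemxAr -scalemxAl.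
apply/matrixP => i j; rewrite !mxE mulr_sumr -big_split/=.
by apply: eq_bigr => k _; rewrite !mxE.
Qed.

HB.instance Definition _ :=
  GRing.isLinear.Build R[i] 'M[R[i]]_n 'M[R[i]]_n _ thermal_fun
    thermal_fun_linear.

Definition thermal_map : 'End('M[R[i]]_n) := linfun thermal_fun.

End ThermalMap.

Definition total_energy (R : realType) (n m : nat)
    (HS : 'M[R[i]]_n) (HB : 'M[R[i]]_m) : 'M[R[i]]_(n * m) :=
  HS *t 1%:M + 1%:M *t HB.

Definition thermal_operations (R : realType) (n : nat)
    (HS : 'M[R[i]]_n) (T : \bar R) : set 'End('M[R[i]]_n) :=
  [set Phi | exists (m : nat) (HB : 'M[R[i]]_m) (U : 'M[R[i]]_(n * m)),
    [/\ (0 < m)%N, HB \is hermsymmx, U \is unitarymx,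
        U *m total_energy HS HB *m U ^t* = total_energy HS HB &
        Phi = thermal_map T HB U]].

(* In R[i], 0 <= z means that z is real and nonnegative, so that positivity of
   the quadratic form already forces A to be Hermitian. *)
Definition psdmx (R : realType) (n : nat) (A : 'M[R[i]]_n) : Prop :=
  forall v : 'cV[R[i]]_n, 0 <= (v ^t* *m A *m v) 0 0.

(* (id (x) f) P on C^k (x) C^n, computed blockwise. *)
Definition ampliation (R : realType) (n k : nat) (f : 'End('M[R[i]]_n))
    (P : 'M[R[i]]_(k * n)) : 'M[R[i]]_(k * n) :=
  \sum_(i < k) \sum_(j < k) delta_mx i j *t
    f (\matrix_(a, b) P (mxtens_index (i, a)) (mxtens_index (j, b))).

Definition completely_positive (R : realType) (n : nat)
    (f : 'End('M[R[i]]_n)) : Prop :=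
  forall (k : nat) (P : 'M[R[i]]_(k * n)), psdmx P -> psdmx (ampliation f P).

Definition trace_preserving (R : realType) (n : nat)
    (f : 'End('M[R[i]]_n)) : Prop :=
  forall X, \tr (f X) = \tr X.

Definition ad_spectrum (R : realType) (n : nat) (HS : 'M[R[i]]_n) : set R[i] :=
  [set a - b | a in eigenvalue HS & b in eigenvalue HS].

Definition resonance_edge (R : realType) (n m : nat)
    (HS : 'M[R[i]]_n) (HB : 'M[R[i]]_m) : rel R[i] :=
  fun x y => [&& eigenvalue HB x, eigenvalue HB y &
                 `[< ad_spectrum HS (x - y) >]].

(* The resonance graph, with vertices the eigenvalues of HB, is connected. *)
Definition resonant_spectrum (R : realType) (n m : nat)
    (HS : 'M[R[i]]_n) (HB : 'M[R[i]]_m) : Prop :=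
  forall x y, eigenvalue HB x -> eigenvalue HB y ->
    exists2 p : seq R[i], path (resonance_edge HS HB) x p & last x p = y.

Definition resonant_thermal_operations (R : realType) (n : nat)
    (HS : 'M[R[i]]_n) (T : \bar R) : set 'End('M[R[i]]_n) :=
  [set Phi | exists (m : nat) (E : 'rV[R]_m) (Htot : 'M[R[i]]_(n * m)),
    let HB := diag_mx (map_mx (real_complex R) E) in
    [/\ (0 < m)%N /\ (forall j k : 'I_m, (j <= k)%N -> E 0 j <= E 0 k),
        resonant_spectrum HS HB, Htot \is hermsymmx,
        Htot *m total_energy HS HB - total_energy HS HB *m Htot = 0 &
        Phi = thermal_map T HB (expmx ('i *: Htot))]].

(* Main.v *)
(* In an eigenbasis of the bath Hamiltonian, with eigenvalues E_b and Gibbs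
   weights p_b, a thermal operation reads
     X |-> sum_(b, c) p_c K_bc X K_bc^*,   K_bc = <b| U |c>,
   where unitarity of U becomes orthonormality of the block rows and columns,
   and energy conservation becomes [HS, K_bc] = (E_c - E_b) K_bc.

   Composition is K_bc L_b'c' on the product bath. The mixture
   (k/N) f + (1 - k/N) g is obtained from a common bath tensored with a trivial
   N-level control register, so the closure is convex. The Gibbs state of HS is
   fixed because energy conservation turns G K_bc p_b into p_c K_bc G. A unitary
   commuting with the total energy is exp(iG) with G Hermitian commuting with it,
   and exp(itG) joins every thermal operation to the identity.

   For (iv), K_bc != 0 forces E_b - E_c into the spectrum of ad_HS, so U is block
   diagonal along the connected components of the resonance graph, and the map is
   a convex combination of thermal operations whose baths are the components.
   These are resonant; products and copies of resonant baths are resonant, so the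
   closure of the resonant operations is convex and contains the combination. *)
From HB Require Import structures.
Require Import Defs.
From mathcomp Require Import all_boot all_order all_algebra.
From mathcomp Require Import all_classical all_reals all_analysis.
From mathcomp Require Import complex mxtens.
From mathcomp Require Import ring.

Import Order.TTheory GRing.Theory Num.Theory.
Import numFieldNormedType.Exports.
Local Open Scope classical_set_scope.
Local Open Scope ring_scope.
Local Open Scope sesquilinear_scope.

Set Implicit Arguments.
Unset Strict Implicit.
Unset Printing Implicit Defensive.

(** * Topology of the space of superoperators *)

Lemma norm_entry_le (K : numFieldType) (m n : nat) (M : 'M[K]_(m, n)) i j :
  `|M i j| <= `|M|.
Proof.
change (`|M i j| <= mx_norm M); rewrite mx_normE.
(* The maximum is taken in the totally ordered type of nonnegative elements, since [K] itself need
   not be totally ordered. *)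
change ((`|M (i, j).1 (i, j).2|%:nng)%:num <=
  (\big[Order.max/0%:nng]_p `|M p.1 p.2|%:nng)%:num).
by rewrite num_le; exact: (le_bigmax _ (fun p => `|M p.1 p.2|%:nng) (i, j)).
Qed.

Lemma cvg_sum (K : numFieldType) (V : normedModType K) (I J : Type)
    (F : set_system I) {FF : Filter F} (r : seq J) (f : J -> I -> V)
    (a : J -> V) :
  (forall j, f j @ F --> a j) ->
  (fun t => \sum_(j <- r) f j t) @ F --> \sum_(j <- r) a j.
Proof.
move=> fa; elim: r => [|j r IH].
  by rewrite big_nil; under eq_fun do rewrite big_nil; exact: cvg_cst.
by rewrite big_cons; under eq_fun do rewrite big_cons; exact: cvgD.
Qed.

(** There are finitely many entries, so their conditions can be intersected in the filter, and the
    maximum norm is either zero or attained at one entry. *)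
Lemma mx_cvgP (K : numFieldType) (m n : nat) (I : Type) (F : set_system I)
    {FF : Filter F} (M : I -> 'M[K]_(m, n)) (L : 'M[K]_(m, n)) :
  (forall i j, (fun t => M t i j) @ F --> L i j) <-> M @ F --> L.
Proof.
split=> [H | H i j].
  apply/cvgrPdist_lt => e e0.
  have : \forall t \near F, forall i j, `|L i j - M t i j| < e.
    apply: filter_forall => i; apply: filter_forall => j.
    by have /cvgrPdist_lt/(_ e e0) := H i j.
  apply: filterS => t Ht.
  have [N0|/mx_norm_neq0[[i j] Nij]] := eqVneq (mx_norm (L - M t)) 0.
    by change (mx_norm (L - M t) < e); rewrite N0.
  by change (mx_norm (L - M t) < e); rewrite Nij/= !mxE.
apply/cvgrPdist_lt => e e0; move/cvgrPdist_lt/(_ e e0): H.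
apply: filterS => t; apply: le_lt_trans.
by have := norm_entry_le (L - M t) i j; rewrite !mxE.
Qed.

Lemma lin_mxE (R : realType) (n : nat) (f : 'End('M[R[i]]_n)) i j k l :
  lin_mx f (mxvec_index i j) (mxvec_index k l) = f (delta_mx i j) k l.
Proof.
rewrite -[RHS](mxvecE (f (delta_mx i j)) k l) -(mul_vec_lin f) mxvec_delta -rowE.
by set M := lin_mx _; rewrite [RHS]mxE.
Qed.

Lemma lfun_entry_le (R : realType) (n : nat) (f : 'End('M[R[i]]_n)) X i j :
  `|f X i j| <= (\sum_k \sum_l `|X k l|) * `|f|.
Proof.
rewrite [X in f X]matrix_sum_delta linear_sum summxE mulr_suml.
apply: le_trans (ler_norm_sum _ _ _) _; apply: ler_sum => k _.
rewrite linear_sum summxE mulr_suml.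
apply: le_trans (ler_norm_sum _ _ _) _; apply: ler_sum => l _.
rewrite linearZ mxE normrM ler_wpM2l//.
by rewrite -lin_mxE; exact: norm_entry_le.
Qed.

(** The entries of the values on matrix units are the entries of the representing matrix. Limits of
    superoperators are computed entrywise through this equivalence. *)
Lemma lfun_cvgP (R : realType) (n : nat) (I : Type) (F : set_system I)
    {FF : Filter F} (g : I -> 'End('M[R[i]]_n)) (l : 'End('M[R[i]]_n)) :
  (forall X i j, (fun t => g t X i j) @ F --> l X i j) <-> g @ F --> l.
Proof.
split=> [H | H X i j].
  have : (fun t => lin_mx (g t)) @ F --> lin_mx l.
    apply/mx_cvgP => i j; case/mxvec_indexP: i => i1 i2.
    case/mxvec_indexP: j => j1 j2; rewrite lin_mxE.
    by under eq_fun do rewrite lin_mxE; exact: H.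
  move=> /cvgrPdist_lt H1; apply/cvgrPdist_lt => e /H1; apply: filterS => t.
  move=> lt_e; apply: le_lt_trans lt_e.
  have -> : lin_mx l - lin_mx (g t) = lin_mx (l - g t).
    apply/matrixP => i j; case/mxvec_indexP: i => i1 i2.
    case/mxvec_indexP: j => j1 j2; rewrite lin_mxE add_lfunE opp_lfunE mxE.
    by rewrite [in RHS]mxE [(- g t _) _ _]mxE -!lin_mxE [X in _ + X = _]mxE.
  by [].
apply/cvgrPdist_lt => e e0.
set C := \sum_k \sum_l `|X k l|.
(* Using C + 1 in place of C keeps the divisor positive when X = 0. *)
have C0 : 0 < C + 1.
  by rewrite ltr_wpDl// sumr_ge0// => k _; rewrite sumr_ge0.
move/cvgrPdist_lt/(_ (e / (C + 1)) (divr_gt0 e0 C0)): H.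
apply: filterS => t; rewrite ltr_pdivlMr// => H; apply: le_lt_trans H.
have := lfun_entry_le (l - g t) X i j.
rewrite add_lfunE opp_lfunE !mxE => /le_trans; apply.
by rewrite mulrC ler_wpM2l// lerDl.
Qed.

Lemma closure_sub_preimage (U V : topologicalType) (h : U -> V) (A : set U)
    (B : set V) :
  continuous h -> A `<=` h @^-1` B -> closure A `<=` h @^-1` closure B.
Proof.
move=> hc AB x clx N Nhx.
have [y [Ay Ny]] := clx _ (hc x N Nhx).
by exists (h y); split => //; exact: AB.
Qed.

Section superoperators.
Variables (R : realType) (n : nat).
Local Notation L := 'End('M[R[i]]_n).

Lemma continuous_lfun_entry X i j : continuous (fun f : L => f X i j).
Proof. by move=> f; have /lfun_cvgP := @cvg_id _ (nbhs f); apply. Qed.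

Lemma cvg_cst_lfun (T : Type) (F : set_system T) {FF : Filter F}
  (l : L) : (fun=> l) @ F --> l.
Proof. exact: cvg_cst. Qed.

Lemma cvg_id_lfun (l : L) : (fun k : L => k) @ l --> l.
Proof. exact: cvg_id. Qed.

Lemma cvg_comp_lfun (I : Type) (F : set_system I) {FF : Filter F}
    (g h : I -> L) (a b : L) :
  g @ F --> a -> h @ F --> b -> (fun t => (g t \o h t)%VF) @ F --> (a \o b)%VF.
Proof.
move=> /lfun_cvgP ga /lfun_cvgP hb; apply/lfun_cvgP => X i j.
(* Entries of a composite are bilinear in entries of the two factors, so joint convergence reduces
   to sums of products. *)
have E (c d : L) : (c \o d)%VF X i j = \sum_k \sum_l d X k l * c (delta_mx k l) i j.
  rewrite lfunE/= [d X]matrix_sum_delta linear_sum summxE; apply: eq_bigr => k _.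
  rewrite linear_sum summxE; apply: eq_bigr => l _.
  by rewrite linearZ mxE -matrix_sum_delta.
rewrite E; under eq_fun do rewrite E.
apply: cvg_sum => k; apply: cvg_sum => l.
by apply: cvgM; [exact: hb|exact: ga].
Qed.

Lemma cvg_lin_comb (I : Type) (F : set_system I) {FF : Filter F}
    (c d : I -> R[i]) (g h : I -> L) (x y : R[i]) (a b : L) :
  c @ F --> x -> d @ F --> y -> g @ F --> a -> h @ F --> b ->
  (fun t => c t *: g t + d t *: h t) @ F --> x *: a + y *: b.
Proof.
move=> cx dy /lfun_cvgP ga /lfun_cvgP hb; apply/lfun_cvgP => X i j.
have E (p q : R[i]) (k l : L) :
    (p *: k + q *: l) X i j = p * k X i j + q * l X i j.
  by rewrite add_lfunE !scale_lfunE !mxE.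
rewrite E; under eq_fun do rewrite E.
by apply: cvgD; apply: cvgM; [exact: cx|exact: ga|exact: dy|exact: hb].
Qed.

Lemma comp_lfun_continuousr h : continuous (fun k : L => (h \o k)%VF).
Proof.
by move=> k; exact: (cvg_comp_lfun (@cvg_cst_lfun _ (nbhs k) _ h) (@cvg_id_lfun k)).
Qed.

Lemma comp_lfun_continuousl h : continuous (fun k : L => (k \o h)%VF).
Proof.
by move=> k; exact: (cvg_comp_lfun (@cvg_id_lfun k) (@cvg_cst_lfun _ (nbhs k) _ h)).
Qed.

Lemma lin_comb_continuousr (c d : R[i]) h :
  continuous (fun k : L => c *: h + d *: k).
Proof.
move=> k; exact: (cvg_lin_comb (@cvg_cst _ _ _ (nbhs k) _) (@cvg_cst _ _ _ (nbhs k) _)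
  (@cvg_cst_lfun _ (nbhs k) _ h) (@cvg_id_lfun k)).
Qed.

Lemma lin_comb_continuousl (c d : R[i]) h :
  continuous (fun k : L => c *: k + d *: h).
Proof.
move=> k; exact: (cvg_lin_comb (@cvg_cst _ _ _ (nbhs k) _) (@cvg_cst _ _ _ (nbhs k) _)
  (@cvg_id_lfun k) (@cvg_cst_lfun _ (nbhs k) _ h)).
Qed.

(* Separate continuity is enough: one takes the closure in one factor at a time. *)
Lemma closure_semigroup (S : set L) :
  semigroup_with_id S -> semigroup_with_id (closure S).
Proof.
case=> S1 SM; split=> [|f g clf clg]; first exact: subset_closure.
have fix_left h : S h -> closure S (h \o g)%VF.
  move=> Sh; apply: (closure_sub_preimage (@comp_lfun_continuousr h)) clg.
  by move=> k Sk; exact: SM.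
rewrite (iffLR (closure_id _) (@closed_closure _ S)).
exact: (closure_sub_preimage (@comp_lfun_continuousl g)) clf.
Qed.

(** Mixtures of points of [S] are only required to lie in the closure, which is what rational
    approximation of the weight provides. The two points are then moved into the closure one at a
    time. *)
Lemma closure_convex (S : set L) :
  (forall f g (r : R), S f -> S g -> 0 <= r <= 1 ->
     closure S (r%:C%C *: f + (1 - r%:C%C) *: g)) ->
  forall f g (r : R), closure S f -> closure S g -> 0 <= r <= 1 ->
     closure S (r%:C%C *: f + (1 - r%:C%C) *: g).
Proof.
move=> Sconv f g r clf clg r01.
have fix_left h : S h -> closure S (r%:C%C *: h + (1 - r%:C%C) *: g).
  move=> Sh; rewrite (iffLR (closure_id _) (@closed_closure _ S)).
  apply: (closure_sub_preimage (@lin_comb_continuousr _ _ h)) clg.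
  by move=> k Sk; exact: Sconv.
rewrite (iffLR (closure_id _) (@closed_closure _ S)).
exact: (closure_sub_preimage (@lin_comb_continuousl _ _ g)) clf.
Qed.

(** [convex_set] ranges over weights in the scalar field [R[i]]; those between 0 and 1 are real. *)
Lemma convex_set_real (S : set L) :
  (forall f g (r : R), S f -> S g -> 0 <= r <= 1 ->
     S (r%:C%C *: f + (1 - r%:C%C) *: g)) -> convex_set S.
Proof.
move=> Sconv f g l; rewrite !inE => Sf Sg.
have [r lr] : exists r : R, l%:num = r%:C%C.
  by apply/complex_realP; apply: ger0_real.
change (S (l%:num *: (f : L) + (1 - l%:num) *: (g : L))).
have l01 : (0 <= l%:num) && (l%:num <= 1 :> R[i]) by apply/andP.
by rewrite lr; apply: Sconv => //; rewrite lr !lecR in l01.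
Qed.

End superoperators.

Lemma norm_real_complex (R : realType) (x : R) : `|x%:C%C| = `|x|%:C%C.
Proof. by rewrite normc_def/= expr0n addr0 sqrtr_sqr. Qed.

Lemma cvg_real_complex (R : realType) (I : Type) (F : set_system I)
    {FF : Filter F} (u : I -> R) (a : R) :
  u @ F --> a -> (fun t => (u t)%:C%C) @ F --> (a%:C%C : R[i]).
Proof.
move=> /cvgrPdist_lt ua; apply/cvgrPdist_lt => e.
rewrite ltcE/= => /andP[/eqP Ie Re0].
apply: filterS (ua _ Re0) => t lt_e.
by rewrite -rmorphB norm_real_complex ltcE/= Ie eqxx.
Qed.

Lemma cvg_complex (R : realType) (I : Type) (F : set_system I)
    {FF : Filter F} (u v : I -> R) (a b : R) :
  u @ F --> a -> v @ F --> b ->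
  (fun t => (u t +i* v t)%C) @ F --> ((a +i* b)%C : R[i]).
Proof.
move=> ua vb.
have E (x y : R) : (x +i* y)%C = x%:C%C + 'i%C * y%:C%C by rewrite [LHS]complexE.
rewrite E; under eq_fun do rewrite E.
apply: cvgD; first exact: cvg_real_complex.
by apply: cvgM; [exact: cvg_cst|exact: cvg_real_complex].
Qed.

Lemma complex_bounded_sub_compact (R : realType) :
  exists2 G : set R[i], compact G & [set z | `|z| <= 1] `<=` G.
Proof.
pose h (p : R * R) : R[i] := (p.1 +i* p.2)%C.
exists (h @` (`[-1, 1] `*` `[-1, 1])).
  apply: continuous_compact; last by apply: compact_setX; exact: segment_compact.
  apply: continuous_subspaceT => p; apply: cvg_complex; [exact: cvg_fst|exact: cvg_snd].
move=> [a b] /= ab1; exists (a, b) => //.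
(* The imaginary part is bounded through the real part of z i, which is - Im z. *)
have := normc_ge_Re (a +i* b)%C; have := normc_ge_Re ((a +i* b)%C * 'i%C).
rewrite normrM complexiE normCi mulr1 -complexiE ReiNIm normrN.
move=> /le_trans/(_ ab1) bh /le_trans/(_ ab1) ah.
by split; rewrite /= in_itv/= -ler_norml -lecR.
Qed.

Section compact_superoperators.
Variables (R : realType) (n : nat).
Local Notation L := 'End('M[R[i]]_n).

(** Left inverse of [lin_mx]; it carries a compact set of coefficients to a compact set of
    superoperators. *)
Definition lfun_of_mx (A : 'M[R[i]]_(n * n)) : L :=
  linfun (vec_mx \o mulmxr A \o mxvec).

Lemma lfun_of_mxE A X i j :
  lfun_of_mx A X i j = \sum_p mxvec X 0 p * A p (mxvec_index i j).
Proof. by rewrite lfunE/= mxE mxE. Qed.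

Lemma lfun_of_mxK (f : L) : lfun_of_mx (lin_mx f) = f.
Proof. by apply/lfunP => X; rewrite lfunE/= mul_vec_lin mxvecK. Qed.

(** A product of compact coefficient sets is compact, its continuous image contains [S], and a
    closed subset of a compact set is compact. *)
Lemma bounded_closed_compact_lfun (S : set L) :
  closed S -> (forall f i j k l, S f -> `|f (delta_mx i j) k l| <= 1) ->
  compact S.
Proof.
move=> Scl Sb; have [G Gc GP] := complex_bounded_sub_compact R.
pose box := [set v : 'rV[R[i]]_((n * n) * (n * n)) | forall p, G (v ord0 p)].
have boxc : compact box by exact: (@rV_compact R[i] _ (fun=> G) (fun=> Gc)).
pose h (v : 'rV[R[i]]_((n * n) * (n * n))) := lfun_of_mx (vec_mx v).
apply: (@subclosed_compact _ S (h @` box)) => //.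
  apply: continuous_compact boxc; apply: continuous_subspaceT => v.
  apply/(@lfun_cvgP _ _ _ (nbhs v) (nbhs_filter v)) => X i j; rewrite lfun_of_mxE.
  under eq_fun do rewrite lfun_of_mxE.
  apply: cvg_sum => p; apply: cvgM; first exact: cvg_cst.
  rewrite [vec_mx v _ _]mxE; under eq_fun do rewrite [vec_mx _ _ _]mxE.
  exact: coord_continuous.
move=> f Sf; exists (mxvec (lin_mx f)); last by rewrite /h mxvecK lfun_of_mxK.
move=> p; case/mxvec_indexP: p => i j; rewrite mxvecE.
case/mxvec_indexP: i => i1 i2; case/mxvec_indexP: j => j1 j2.
by rewrite lin_mxE; apply: GP; exact: Sb.
Qed.

Lemma bounded_set_lfun (S : set L) :
  (forall f i j k l, S f -> `|f (delta_mx i j) k l| <= 1) -> bounded_set S.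
Proof.
move=> Sb; exists 1; split=> [|M M1 f Sf]; first exact: real1.
apply: le_trans (ltW M1).
have Ab i j : `|lin_mx f i j| <= 1.
  case/mxvec_indexP: i => i1 i2; case/mxvec_indexP: j => j1 j2.
  by rewrite lin_mxE; exact: Sb.
have [N0|/mx_norm_neq0[[i j] Nij]] := eqVneq (mx_norm (lin_mx f)) 0.
  by change (mx_norm (lin_mx f) <= 1); rewrite N0.
by change (mx_norm (lin_mx f) <= 1); rewrite Nij Ab.
Qed.

End compact_superoperators.

(** * Matrix exponential of diagonalizable matrices *)

Section matrix_exponential.
Variable R : realType.

Lemma cvg_exp_series_real (x : R) :
  series (fun k => (k`!%:R)^-1 * (x%:C%C) ^+ k) @ \oo --> ((expR x)%:C%C : R[i]).
Proof.
have -> : series (fun k => (k`!%:R)^-1 * (x%:C%C) ^+ k) =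
    (fun n => (series (exp_coeff x) n)%:C%C).
  apply/funext => n; rewrite /series/= rmorph_sum; apply: eq_bigr => k _.
  by rewrite /exp_coeff/= rmorphM rmorphXn fmorphV rmorph_nat mulrC.
apply: cvg_real_complex; exact: is_cvg_series_exp_coeff.
Qed.

Lemma cvg_exp_series_imag (x : R) :
  series (fun k => (k`!%:R)^-1 * ('i * x%:C%C) ^+ k) @ \oo -->
    ((cos x +i* sin x)%C : R[i]).
Proof.
have -> : series (fun k => (k`!%:R)^-1 * ('i * x%:C%C) ^+ k) =
    (fun n => (series (cos_coeff x) n +i* series (sin_coeff x) n)%C).
  apply/funext => n; rewrite [RHS]complexE /series/= !rmorph_sum mulr_sumr.
  rewrite -big_split/=; apply: eq_bigr => k _.
  rewrite /cos_coeff /sin_coeff/= -exprnP !(rmorphM, fmorphV)/=.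
  rewrite !(rmorphXn, rmorph_nat, rmorphN1) exprMn complexiE.
  (* Split by parity: for k = 2l the power of i is (-1)^l and gives a cosine term; for k = 2l + 1
     the extra factor i gives a sine term. *)
  have := odd_double_half k; case: (odd k) => /= <-.
    by rewrite doubleK exprS -mul2n exprM sqrCi; ring.
  by rewrite add0n doubleK -mul2n exprM sqrCi; ring.
rewrite cos.unlock sin.unlock.
apply: cvg_complex; [exact: is_cvg_series_cos_coeff|exact: is_cvg_series_sin_coeff].
Qed.

(** The arccosine of the real part gives the angle up to sign, and the sign of the imaginary part
    chooses it. *)
Lemma unimodular_cos_sin (z : R[i]) : `|z| = 1 ->
  exists t : R, z = (cos t +i* sin t)%C.
Proof.
case: z => a b z1.
have ab1 : a ^+ 2 + b ^+ 2 = 1.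
  by apply: (@complexI R); have /= -> := add_Re2_Im2 (a +i* b)%C; rewrite z1 expr1n.
have aB : -1 <= a <= 1.
  rewrite -ler_norml -(@ler_pXn2r _ 2%N)// ?nnegrE// real_normK ?num_real//.
  by rewrite expr1n -ab1 lerDl sqr_ge0.
have b2 : Num.sqrt (1 - a ^+ 2) = `|b| by rewrite -ab1 addrAC subrr add0r sqrtr_sqr.
have [b0|b0] := leP 0 b.
  by exists (acos a); rewrite acosK ?in_itv// sin_acos// b2 ger0_norm.
exists (- acos a); rewrite cosN sinN acosK ?in_itv// sin_acos// b2.
by rewrite ltr0_norm// opprK.
Qed.

Lemma expr_conj_unitary n (V A : 'M[R[i]]_n) k : V \is unitarymx ->
  (V^t* *m A *m V) ^+ k = V^t* *m A ^+ k *m V.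
Proof.
move=> Vu; elim: k => [|k IH].
  by rewrite !expr0 mulmx1 -invmx_unitary// mulVmx ?unitarymx_unit.
rewrite !exprS IH -!mulmxE !mulmxA; congr (_ *m _ *m _).
by rewrite mulmxtVK.
Qed.

Lemma expr_diag_mx n (d : 'rV[R[i]]_n) k :
  diag_mx d ^+ k = diag_mx (map_mx (fun z => z ^+ k) d).
Proof.
elim: k => [|k IH].
  by apply/matrixP => i j; rewrite expr0 !mxE expr0.
rewrite exprS IH -mulmxE mulmx_diag; congr diag_mx.
by apply/rowP => i; rewrite !mxE exprS.
Qed.

(** Powers commute with unitary conjugation, so the matrix series reduces to the scalar exponential
    series of the eigenvalues. *)
Lemma expmx_conj_diag n (V : 'M[R[i]]_n) (d e : 'rV[R[i]]_n) :
  V \is unitarymx ->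
  (forall i, series (fun k => (k`!%:R)^-1 * (d 0 i) ^+ k) @ \oo --> e 0 i) ->
  expmx (V^t* *m diag_mx d *m V) = V^t* *m diag_mx e *m V.
Proof.
move=> Vu de; apply: cvg_lim; first exact: norm_hausdorff.
apply/(@mx_cvgP _ _ _ _ \oo) => i j.
pose s (u : 'rV[R[i]]_n) := \sum_k (V^t*) i k * u 0 k * V k j.
have E u : (V^t* *m diag_mx u *m V) i j = s u.
  by rewrite mxE; apply: eq_bigr => k _; rewrite mul_mx_diag mxE.
rewrite E.
have -> : (fun t => series (fun k =>
      (k`!%:R)^-1 *: (V^t* *m diag_mx d *m V) ^+ k) t i j) =
    (fun t => \sum_k (V^t*) i k * series (fun l => (l`!%:R)^-1 * (d 0 k) ^+ l) t * V k j).
  apply/funext => t; rewrite /series/= summxE.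
  have E2 l : ((l`!%:R)^-1 *: (V^t* *m diag_mx d *m V) ^+ l) i j =
      (l`!%:R)^-1 * s (map_mx (fun z => z ^+ l) d).
    by rewrite expr_conj_unitary// expr_diag_mx mxE E.
  transitivity (\sum_(0 <= l < t) \sum_k
      (V^t*) i k * ((l`!%:R)^-1 * (d 0 k) ^+ l) * V k j).
    apply: eq_bigr => l _; rewrite [LHS]E2 mulr_sumr; apply: eq_bigr => k _.
    by rewrite !mulrA; congr (_ * _ * _); [exact: mulrC|rewrite mxE].
  rewrite exchange_big/=; apply: eq_bigr => k _.
  by rewrite mulr_sumr mulr_suml.
apply: cvg_sum => k; apply: cvgM; last exact: cvg_cst.
by apply: cvgM; [exact: cvg_cst|exact: de].
Qed.

End matrix_exponential.

(** * Block form of thermal operations *)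

Section kraus.
Variables (C : numClosedFieldType) (n : nat).
Local Notation M := 'M[C]_n.

(* K b c stands for <b| U |c>, and p for the weights of the bath state. *)
Definition kraus_fun (B : finType) (p : B -> C) (K : B -> B -> M) (X : M) : M :=
  \sum_b \sum_c p c *: (K b c *m X *m (K b c)^t*).

(** The two relations are U^* U = 1 and U U^* = 1 written in blocks. The first yields trace
    preservation, the second the fixed Gibbs state. *)
Definition block_unitary (B : finType) (K : B -> B -> M) : Prop :=
  (forall c d, \sum_b (K b c)^t* *m K b d = (c == d)%:R%:M) /\
  (forall b d, \sum_c K b c *m (K d c)^t* = (b == d)%:R%:M).

Definition block_energy_preserving (B : finType) (H : M) (E : B -> C)
    (K : B -> B -> M) : Prop :=
  forall b c, H *m K b c - K b c *m H = (E c - E b) *: K b c.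

Lemma trmxC_mul m k l (A : 'M[C]_(m, k)) (D : 'M[C]_(k, l)) :
  (A *m D)^t* = D^t* *m A^t*.
Proof. by rewrite trmx_mul map_mxM. Qed.

Lemma scalar_mx0 m : (0%:M : 'M[C]_m) = 0.
Proof. by rewrite -scalemx1 scale0r. Qed.

Lemma trmxC_scalar m (a : C) : (a%:M : 'M[C]_m)^t* = (a^*)%:M.
Proof. by rewrite tr_scalar_mx map_scalar_mx. Qed.

Lemma trmxC_scale m k (a : C) (A : 'M[C]_(m, k)) : (a *: A)^t* = a^* *: A^t*.
Proof. by apply/matrixP => i j; rewrite !mxE rmorphM. Qed.

Lemma block_unitary_id (B : finType) :
  block_unitary (fun b c : B => (b == c)%:R%:M).
Proof.
split=> b d; rewrite (bigD1 b)//= big1 ?addr0 => [|c /negPf cb].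
- by rewrite eqxx trmxC_scalar rmorph1 mul1mx.
- by rewrite cb trmxC_scalar rmorph0 scalar_mx0 mul0mx.
- by rewrite eqxx mul1mx trmxC_scalar rmorph_nat eq_sym.
- by rewrite eq_sym cb scalar_mx0 mul0mx.
Qed.

Lemma block_energy_preserving_id (B : finType) (H : M) (E : B -> C) :
  block_energy_preserving H E (fun b c : B => (b == c)%:R%:M).
Proof.
move=> b c; have [->|_] := eqVneq b c; last first.
  by rewrite scalar_mx0 mulmx0 mul0mx scaler0 subrr.
by rewrite mulmx1 mul1mx !subrr scale0r.
Qed.

Lemma kraus_fun_id (B : finType) (p : B -> C) X :
  kraus_fun p (fun b c : B => (b == c)%:R%:M) X = (\sum_c p c) *: X.
Proof.
rewrite scaler_suml; apply: eq_bigr => b _; rewrite (bigD1 b)//= big1 ?addr0.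
  by rewrite eqxx mul1mx trmxC_scalar rmorph1 mulmx1.
by move=> c /negPf cb; rewrite eq_sym cb scalar_mx0 !mul0mx scaler0.
Qed.

Section composition.
Variables (B1 B2 : finType) (K1 : B1 -> B1 -> M) (K2 : B2 -> B2 -> M).
Definition block_comp (b c : B1 * B2) : M := K1 b.1 c.1 *m K2 b.2 c.2.

(** Each sum collapses from the innermost product: K1^* K1 for columns, K2 K2^* for rows. Hence the
    two sums are exchanged in the column case. *)
Lemma block_unitary_comp :
  block_unitary K1 -> block_unitary K2 -> block_unitary block_comp.
Proof.
move=> [col1 row1] [col2 row2]; split=> -[b1 b2] [c1 c2]; rewrite /block_comp/=.
  rewrite -(pair_bigA _ (fun a1 a2 => (K1 a1 b1 *m K2 a2 b2)^t* *m
    (K1 a1 c1 *m K2 a2 c2)))/= exchange_big/=.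
  under eq_bigr => a2 _.
    under eq_bigr => a1 _ do rewrite trmxC_mul -mulmxA [(K1 _ _)^t* *m _]mulmxA.
    rewrite -mulmx_sumr -mulmx_suml col1 mul_scalar_mx -scalemxAr.
    over.
  by rewrite -scaler_sumr col2 scale_scalar_mx -natrM mulnb xpair_eqE.
rewrite -(pair_bigA _ (fun a1 a2 => (K1 b1 a1 *m K2 b2 a2) *m
  (K1 c1 a1 *m K2 c2 a2)^t*))/=.
under eq_bigr => a1 _.
  under eq_bigr => a2 _ do rewrite trmxC_mul -mulmxA [K2 _ _ *m _]mulmxA.
  rewrite -mulmx_sumr -mulmx_suml row2 mul_scalar_mx -scalemxAr.
  over.
by rewrite -scaler_sumr row1 scale_scalar_mx -natrM mulnb xpair_eqE andbC.
Qed.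

(** The commutator with [H] is a derivation, so the energy shifts of the two factors add. *)
Lemma block_energy_preserving_comp H (E1 : B1 -> C) (E2 : B2 -> C) :
  block_energy_preserving H E1 K1 -> block_energy_preserving H E2 K2 ->
  block_energy_preserving H (fun b => E1 b.1 + E2 b.2) block_comp.
Proof.
move=> e1 e2 [b1 b2] [c1 c2]; rewrite /block_comp/=.
have /(canRL (subrK _)) h1 := e1 b1 c1; have /(canRL (subrK _)) h2 := e2 b2 c2.
rewrite mulmxA h1 mulmxDl -[_ *m H *m _]mulmxA h2 mulmxDr !mulmxA addrA addrK.
by rewrite -scalemxAl -scalemxAr -scalerDl; congr (_ *: _); ring.
Qed.

Lemma kraus_fun_comp (p1 : B1 -> C) (p2 : B2 -> C) X :
  kraus_fun (fun c => p1 c.1 * p2 c.2) block_comp X =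
  kraus_fun p1 K1 (kraus_fun p2 K2 X).
Proof.
pose t b1 b2 c1 c2 := (p1 c1 * p2 c2) *:
  (K1 b1 c1 *m K2 b2 c2 *m X *m (K1 b1 c1 *m K2 b2 c2)^t*).
transitivity (\sum_b1 \sum_b2 \sum_c1 \sum_c2 t b1 b2 c1 c2).
  rewrite pair_bigA; apply: eq_bigr => b _; rewrite pair_bigA.
  by apply: eq_bigr.
apply: eq_bigr => b1 _; rewrite exchange_big; apply: eq_bigr => c1 _.
rewrite mulmx_sumr mulmx_suml scaler_sumr; apply: eq_bigr => b2 _.
rewrite mulmx_sumr mulmx_suml scaler_sumr; apply: eq_bigr => c2 _.
by rewrite /t trmxC_mul -!scalemxAr -!scalemxAl scalerA !mulmxA.
Qed.
End composition.

Section mixture.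
Variables (B : finType) (N : nat) (K : 'I_N -> B -> B -> M).

(* The register 'I_N is classical control: level j triggers K j. *)
Definition block_mix (b c : B * 'I_N) : M := (b.2 == c.2)%:R *: K b.2 b.1 c.1.

Lemma block_unitary_mix :
  (forall j, block_unitary (K j)) -> block_unitary block_mix.
Proof.
move=> Ku; split=> -[b j] [c l]; rewrite /block_mix/=.
  rewrite -(pair_bigA _ (fun a i => ((i == j)%:R *: K i a b)^t* *m
    ((i == l)%:R *: K i a c)))/= exchange_big (bigD1 j)//= [X in _ + X]big1.
    under eq_bigr => a _ do rewrite eqxx scale1r -scalemxAr.
    by rewrite -scaler_sumr (Ku j).1 addr0 scale_scalar_mx -natrM mulnb xpair_eqE andbC.
  move=> i /negPf ij; rewrite big1// => a _.
  by rewrite ij scale0r trmx0 map_mx0 mul0mx.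
rewrite -(pair_bigA _ (fun a i => ((j == i)%:R *: K j b a) *m
  ((l == i)%:R *: K l c a)^t*))/= exchange_big (bigD1 j)//= [X in _ + X]big1.
  under eq_bigr => a _ do rewrite eqxx scale1r trmxC_scale rmorph_nat -scalemxAr.
  rewrite -scaler_sumr addr0 xpair_eqE andbC eq_sym.
  have [->|_] := eqVneq j l; first by rewrite scale1r (Ku l).2.
  by rewrite scale0r -[RHS]scalemx1 scale0r.
move=> i /negPf ij; rewrite big1// => a _.
by rewrite eq_sym ij scale0r mul0mx.
Qed.

Lemma block_energy_preserving_mix H (E : B -> C) :
  (forall j, block_energy_preserving H E (K j)) ->
  block_energy_preserving H (fun b => E b.1) block_mix.
Proof.
move=> Ke [b j] [c l]; rewrite /block_mix/= -scalemxAr -scalemxAl -scalerBr Ke.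
by rewrite !scalerA mulrC.
Qed.

(** A block joining different register levels is zero, so the cross terms vanish and the mixture is
    incoherent. *)
Lemma kraus_fun_mix (p : B -> C) (q : C) X :
  kraus_fun (fun c => p c.1 * q) block_mix X =
  \sum_j q *: kraus_fun p (K j) X.
Proof.
pose t b j c l := (p c * q) *:
  ((j == l)%:R *: K j b c *m X *m ((j == l)%:R *: K j b c)^t*).
transitivity (\sum_b \sum_j \sum_c \sum_l t b j c l).
  rewrite pair_bigA; apply: eq_bigr => b _; rewrite pair_bigA.
  by apply: eq_bigr.
rewrite exchange_big; apply: eq_bigr => j _.
rewrite scaler_sumr; apply: eq_bigr => b _.
rewrite scaler_sumr; apply: eq_bigr => c _.
rewrite (bigD1 j)//= [X in _ + X]big1 => [|i /negPf ij].
  by rewrite /t eqxx !scale1r addr0 scalerA mulrC.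
by rewrite /t eq_sym ij scale0r !mul0mx scaler0.
Qed.
End mixture.

Section restriction.
Variables (B : finType) (D : {pred B}) (K : B -> B -> M).
Hypothesis K_block : forall b c, (b \in D) != (c \in D) -> K b c = 0.

Definition block_restr (b c : {x in D}) : M := K (val b) (val c).

Lemma block_unitary_restr : block_unitary K -> block_unitary block_restr.
Proof.
move=> [col row]; split=> b c; rewrite /block_restr.
  rewrite -(big_sub D (fun a => (K a (val b))^t* *m K a (val c))).
  rewrite -[b == c]val_eqE -col [RHS](bigID (mem D))/= [X in _ + X]big1 ?addr0// => a aD.
  by rewrite [K a (val c)]K_block ?mulmx0// (negPf aD) (valP c).
rewrite -(big_sub D (fun a => K (val b) a *m (K (val c) a)^t*)).
rewrite -[b == c]val_eqE -row [RHS](bigID (mem D))/= [X in _ + X]big1 ?addr0// => a aD.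
by rewrite [K (val b) a]K_block ?mul0mx// (negPf aD) (valP b).
Qed.

(** In the application q is the total weight of [D], and dividing by it makes the weights a
    probability on [D]. Since [K] does not connect [D] to its complement, the sum over b may run
    over all of [B]. *)
Lemma kraus_fun_restr (p : B -> C) (q : C) X : q != 0 ->
  q *: kraus_fun (fun c : {x in D} => p (val c) / q) block_restr X =
  \sum_(c in D) \sum_b p c *: (K b c *m X *m (K b c)^t*).
Proof.
move=> q0.
rewrite scaler_sumr [RHS]exchange_big (bigID (mem D))/= [X in _ + X]big1 ?addr0.
  rewrite [RHS](big_sub D); apply: eq_bigr => b _.
  rewrite scaler_sumr (big_sub D); apply: eq_bigr => c _.
  by rewrite /block_restr !scalerA mulrC divfK.
move=> b bD; rewrite big1// => c cD.
by rewrite K_block ?mul0mx ?scaler0// (negPf bD) cD.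
Qed.

End restriction.
End kraus.

(** * Kraus maps: trace, fixed points and a uniform bound *)

Section kraus_channel.
Variables (C : numClosedFieldType) (n : nat) (B : finType).
Variables (p : B -> C) (K : B -> B -> 'M[C]_n).
Hypotheses (p_ge0 : forall c, 0 <= p c) (p_sum1 : \sum_c p c = 1).
Hypothesis Ku : block_unitary K.

Lemma kraus_fun_trace X : \tr (kraus_fun p K X) = \tr X.
Proof.
rewrite /kraus_fun exchange_big linear_sum/=.
transitivity (\sum_c p c * \tr X); last by rewrite -mulr_suml p_sum1 mul1r.
apply: eq_bigr => c _; rewrite -scaler_sumr linearZ/= linear_sum/=; congr (_ * _).
under eq_bigr => b _ do rewrite -mulmxA mxtrace_mulC -mulmxA.
rewrite -linear_sum/= -mulmx_sumr Ku.1.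
by rewrite eqxx mulmx1.
Qed.

(** The intertwining relation moves [G] to the left of the two blocks and turns the weight of c into
    that of b; the row relation then sums the blocks to 1. *)
Lemma kraus_fun_fixed (G : 'M[C]_n) :
  (forall b c, p c *: (K b c *m G) = p b *: (G *m K b c)) ->
  kraus_fun p K G = G.
Proof.
move=> KG; rewrite /kraus_fun.
transitivity (\sum_b p b *: G); last by rewrite -scaler_suml p_sum1 scale1r.
apply: eq_bigr => b _.
under eq_bigr => c _ do rewrite scalemxAl KG -scalemxAl -mulmxA.
by rewrite -scaler_sumr -mulmx_sumr Ku.2 eqxx mulmx1.
Qed.

(** For fixed c and i, the entries over all b and k form a column of the unitary, hence a unit
    vector; fixing k keeps a part of it. *)
Lemma block_col_norm c i k : \sum_b `|K b c k i| ^+ 2 <= 1.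
Proof.
have <- : \sum_b ((K b c)^t* *m K b c) i i = 1.
  by rewrite -summxE Ku.1 mxE !eqxx.
apply: ler_sum => b _; rewrite !mxE (bigD1 k)//= !mxE.
rewrite -normCKC lerDl sumr_ge0// => l _.
by rewrite !mxE -normCKC exprn_ge0.
Qed.

(** On a matrix unit each Kraus term is a product of two entries. The inequality xy <= (x^2 + y^2)/2
    and the column bound give at most 1 for each c, and the weights sum to 1. Boundedness and
    compactness rest on this bound. *)
Lemma kraus_fun_delta_le1 i j k l : `|kraus_fun p K (delta_mx i j) k l| <= 1.
Proof.
rewrite /kraus_fun exchange_big summxE; apply: le_trans (ler_norm_sum _ _ _) _.
rewrite -p_sum1; apply: ler_sum => c _; rewrite -scaler_sumr mxE normrM.
rewrite ger0_norm// -[leRHS]mulr1 ler_wpM2l// summxE.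
apply: le_trans (ler_norm_sum _ _ _) _.
apply: (@le_trans _ _ (\sum_b (`|K b c k i| ^+ 2 + `|K b c l j| ^+ 2) / 2)).
  apply: ler_sum => b _.
  have -> : (K b c *m delta_mx i j *m (K b c)^t*) k l = K b c k i * (K b c l j)^*.
    rewrite -(mul_delta_mx (0 : 'I_1)) mulmxA -colE -mulmxA -rowE mxE.
    by rewrite big_ord1 !mxE.
  rewrite normrM norm_conjC -subr_ge0.
  set x := `|_|; set y := `|_|.
  have -> : (x ^+ 2 + y ^+ 2) / 2 - x * y = (x - y) ^+ 2 / 2 by field.
  rewrite divr_ge0// -real_normK ?exprn_ge0// rpredB// ger0_real//; exact: normr_ge0.
rewrite -mulr_suml big_split/= ler_pdivrMr// mul1r.
by rewrite -[2%:R](_ : 1 + 1 = 2)//; apply: lerD; exact: block_col_norm.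
Qed.

End kraus_channel.

Lemma big_mxtens (V : nmodType) m k (F : 'I_(m * k) -> V) :
  \sum_q F q = \sum_i \sum_j F (mxtens_index (i, j)).
Proof.
rewrite pair_bigA; rewrite (reindex (@mxtens_index m k)) /=.
  by apply: eq_bigr => -[i j].
exists (@mxtens_unindex m k) => q _; [exact: mxtens_indexK|exact: mxtens_unindexK].
Qed.

(** * Ampliations of Kraus maps *)

Section ampliation.
Variables (C : numClosedFieldType).

Definition mxtens_block k n (P : 'M[C]_(k * n)) (i j : 'I_k) : 'M[C]_n :=
  \matrix_(a, b) P (mxtens_index (i, a)) (mxtens_index (j, b)).

Lemma delta_tens_sumE k n (F : 'I_k -> 'I_k -> 'M[C]_n) i a j b :
  (\sum_i' \sum_j' delta_mx i' j' *t F i' j') (mxtens_index (i, a))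
    (mxtens_index (j, b)) = F i j a b.
Proof.
rewrite summxE (bigD1 i)//= [X in _ + X]big1 ?addr0 => [|i' /negPf ii].
  rewrite summxE (bigD1 j)//= [X in _ + X]big1 ?addr0 => [|j' /negPf jj].
    by rewrite tensmxE mxE !eqxx mul1r.
  by rewrite tensmxE mxE [j == _]eq_sym jj andbF mul0r.
rewrite summxE big1// => j' _.
by rewrite tensmxE mxE [i == _]eq_sym ii mul0r.
Qed.

Lemma mxtens_block_sum k n (P : 'M[C]_(k * n)) :
  P = \sum_i \sum_j delta_mx i j *t mxtens_block P i j.
Proof.
apply/matrixP => q r; case: (mxtens_indexP q) => i a.
by case: (mxtens_indexP r) => j b; rewrite delta_tens_sumE mxE.
Qed.

Lemma trmxC_tens m n k l (A : 'M[C]_(m, n)) (D : 'M[C]_(k, l)) :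
  (A *t D)^t* = A^t* *t D^t*.
Proof. by rewrite trmx_tens map_mxT. Qed.

Lemma conj_tens_block k n (A : 'M[C]_n) (P : 'M[C]_(k * n)) :
  (1%:M *t A) *m P *m (1%:M *t A)^t* =
  \sum_i \sum_j delta_mx i j *t (A *m mxtens_block P i j *m A^t*).
Proof.
rewrite [P in LHS]mxtens_block_sum mulmx_sumr mulmx_suml.
apply: eq_bigr => i _; rewrite mulmx_sumr mulmx_suml.
apply: eq_bigr => j _; rewrite trmxC_tens trmxC_scalar.
by rewrite !tensmx_mul mul1mx conjC1 mulmx1.
Qed.

(** Ampliation replaces each block K by 1 tensor K, so the result is again a weighted sum of
    conjugations; complete positivity follows from this form. *)
Lemma kraus_fun_ampliation k n (B : finType) (p : B -> C)
    (K : B -> B -> 'M[C]_n) (P : 'M[C]_(k * n)) :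
  \sum_i \sum_j delta_mx i j *t kraus_fun p K (mxtens_block P i j) =
  \sum_b \sum_c p c *: ((1%:M *t K b c) *m P *m (1%:M *t K b c)^t*).
Proof.
apply/matrixP => q r; case: (mxtens_indexP q) => i a.
case: (mxtens_indexP r) => j b; rewrite delta_tens_sumE !summxE.
apply: eq_bigr => d _; rewrite !summxE; apply: eq_bigr => c _.
by rewrite conj_tens_block mxE [RHS]mxE delta_tens_sumE.
Qed.

End ampliation.

(** * Energy eigenbasis of the system *)

Section energy_basis.
Variables (C : numClosedFieldType) (n : nat) (V : 'M[C]_n) (d : 'rV[C]_n).
Hypothesis Vu : V \is unitarymx.

Lemma unitary_mulCV : V^t* *m V = 1%:M.
Proof. by rewrite -invmx_unitary// mulVmx// unitarymx_unit. Qed.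

Lemma eq_conj_diag (e : 'rV[C]_n) : (forall i, d 0 i = e 0 i) ->
  V^t* *m diag_mx d *m V = V^t* *m diag_mx e *m V.
Proof. by move=> de; congr (_ *m diag_mx _ *m _); apply/rowP. Qed.

Lemma unitary_conj_eq0 (K : 'M[C]_n) : V *m K *m V^t* = 0 -> K = 0.
Proof.
move=> VK0; have := congr1 (fun A => V^t* *m A *m V) VK0.
by rewrite /= !mulmxA unitary_mulCV mul1mx -mulmxA unitary_mulCV mulmx1 mulmx0 mul0mx.
Qed.

Lemma eigenvalue_conj_diag i : eigenvalue (V^t* *m diag_mx d *m V) (d 0 i).
Proof.
apply/eigenvalueP; exists (row i V).
  rewrite -row_mul !mulmxA (unitarymxP Vu) mul1mx.
  by apply/rowP => j; rewrite mul_diag_mx !mxE.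
apply/eqP => ri0; have /matrixP/(_ i i) := unitarymxP Vu.
rewrite mxE big1 => [|k _]; first by rewrite mxE eqxx => /esym/eqP; rewrite oner_eq0.
by have /rowP/(_ k) := ri0; rewrite !mxE => ->; rewrite mul0r.
Qed.
End energy_basis.

(** In the eigenbasis the commutator relation reads (d_i - d_j) A_ij = (E_c - E_b) A_ij entry by
    entry, so a nonzero entry determines the transition energy. *)
Lemma block_entry_energy (C : numClosedFieldType) n (V : 'M[C]_n)
    (d : 'rV[C]_n) (B : finType) (E : B -> C) (K : B -> B -> 'M[C]_n) :
  V \is unitarymx ->
  block_energy_preserving (V^t* *m diag_mx d *m V) E K ->
  forall b c i j, (V *m K b c *m V^t*) i j != 0 -> d 0 i - d 0 j = E c - E b.
Proof.
move=> Vu Ke b c i j Kij; apply: (mulIf Kij).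
set A := V *m K b c *m V^t*.
have /matrixP/(_ i j) : diag_mx d *m A - A *m diag_mx d = (E c - E b) *: A.
  rewrite /A scalemxAl scalemxAr -Ke mulmxBr mulmxBl !mulmxA.
  by rewrite (mulmxtVK _ Vu) (unitarymxP Vu) mul1mx.
by rewrite mul_diag_mx mul_mx_diag !mxE => <-; rewrite mulrBl [d 0 j * _]mulrC.
Qed.

(** * Gibbs weights of a bath *)

Section block_thermal.
Variables (R : realType) (n : nat) (HS : 'M[R[i]]_n) (beta : R).
Local Notation L := 'End('M[R[i]]_n).

(** Parametrized by the inverse temperature, so that infinite temperature is the ordinary value
    [beta = 0], with uniform weights. *)
Definition gibbs (B : finType) (E : B -> R) (c : B) : R :=
  expR (- (beta * E c)) / \sum_b expR (- (beta * E b)).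

Section gibbs.
Variables (B : finType) (E : B -> R).

Lemma partition_gt0 (b : B) : 0 < \sum_b expR (- (beta * E b)).
Proof.
by rewrite (bigD1 b)//= ltr_pwDl ?expR_gt0// sumr_ge0.
Qed.

Lemma gibbs_gt0 c : 0 < gibbs E c.
Proof. by rewrite divr_gt0 ?expR_gt0// (partition_gt0 c). Qed.

Lemma gibbs_sum1 : (0 < #|B|)%N -> \sum_c gibbs E c = 1.
Proof.
by move=> /card_gt0P[b _]; rewrite -mulr_suml divff// gt_eqF// (partition_gt0 b).
Qed.

Lemma gibbs_prod (B' : finType) (E' : B' -> R) c :
  gibbs (fun b : B * B' => E b.1 + E' b.2) c = gibbs E c.1 * gibbs E' c.2.
Proof.
rewrite /gibbs mulrDr opprD expRD.
have -> : \sum_(b : B * B') expR (- (beta * (E b.1 + E' b.2))) =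
    (\sum_b expR (- (beta * E b))) * \sum_b expR (- (beta * E' b)).
  rewrite big_distrlr/= pair_bigA; apply: eq_bigr => b _.
  by rewrite mulrDr opprD expRD.
by rewrite invfM mulrACA.
Qed.

Lemma gibbs_copies N c :
  gibbs (fun b : B * 'I_N => E b.1) c = gibbs E c.1 * N%:R^-1.
Proof.
rewrite /gibbs -(pair_bigA _ (fun b _ => expR (- (beta * E b))))/=.
under eq_bigr => b _ do rewrite sumr_const card_ord -mulr_natr.
by rewrite -mulr_suml invfM mulrA.
Qed.

(** Conditioning a Gibbs distribution on a set of levels gives the Gibbs distribution of those
    levels, as the full partition function cancels. *)
Lemma gibbs_restr (D : {pred B}) (c : {x in D}) :
  gibbs (fun b : {x in D} => E (val b)) c =
  gibbs E (val c) / \sum_(b in D) gibbs E b.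
Proof.
rewrite /gibbs -(big_sub D (fun b => expR (- (beta * E b)))) -mulr_suml.
have Z0 := gt_eqF (partition_gt0 (val c)).
by rewrite [in RHS]invfM invrK -mulrA [_^-1 * (_ * _)]mulrCA mulVf ?mulr1 ?Z0.
Qed.
End gibbs.
End block_thermal.

Section kraus_linear.
Variables (C : numClosedFieldType) (n : nat) (B : finType).
Variables (p : B -> C) (K : B -> B -> 'M[C]_n).

Lemma kraus_fun_linear : linear (kraus_fun p K).
Proof.
move=> a X Y; rewrite /kraus_fun scaler_sumr -big_split; apply: eq_bigr => b _.
rewrite scaler_sumr -big_split; apply: eq_bigr => c _ /=.
rewrite mulmxDr mulmxDl scalerDr -scalemxAr -scalemxAl !scalerA; congr (_ *: _ + _).
exact: mulrC.
Qed.

HB.instance Definition _ :=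
  GRing.isLinear.Build C 'M[C]_n 'M[C]_n _ (kraus_fun p K) kraus_fun_linear.
End kraus_linear.

Lemma rational_average (F : numFieldType) (V : lmodType F) (x y : V) k N :
  (k <= N)%N -> (0 < N)%N ->
  N%:R^-1 *: (x *+ k + y *+ (N - k)) =
  (k%:R / N%:R) *: x + (1 - k%:R / N%:R) *: y.
Proof.
move=> kN N0; have N0' : N%:R != 0 :> F by rewrite pnatr_eq0 -lt0n.
rewrite scalerDr -[x *+ k]scaler_nat -[y *+ _]scaler_nat !scalerA natrB// mulrBr mulVf//.
by rewrite ![N%:R^-1 * _]mulrC.
Qed.

(** * Composition and rational mixtures of block thermal operations *)

Section block_thermal.
Variables (R : realType) (n : nat) (HS : 'M[R[i]]_n) (beta : R).
Local Notation L := 'End('M[R[i]]_n).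
Local Notation toC := (real_complex R).

(* Connectedness of the resonance graph, as the absence of proper nonempty
   invariant subsets of the bath levels. *)
Definition resonant_energies (B : finType) (E : B -> R) : Prop :=
  forall P : pred B, (exists b, P b) ->
    (forall b c, ad_spectrum HS (toC (E b) - toC (E c)) -> P b -> P c) ->
    forall b, P b.

Definition gibbs_kraus (B : finType) (E : B -> R) (K : B -> B -> 'M[R[i]]_n) : L :=
  linfun (kraus_fun (toC \o gibbs beta E) K).

(** The flag [res] adds resonance, so that the same lemmas cover thermal and resonant operations.
    Bath levels form an arbitrary finite type, which lets product baths and components be taken
    directly. *)
Definition block_thermal (res : bool) : set L := [set Phi |
  exists (B : finType) (E : B -> R) (K : B -> B -> 'M[R[i]]_n),
    [/\ (0 < #|B|)%N, block_unitary K, block_energy_preserving HS (toC \o E) K,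
        res -> resonant_energies E & Phi = gibbs_kraus E K]].

Lemma gibbs_kraus_id (B : finType) (E : B -> R) : (0 < #|B|)%N ->
  gibbs_kraus E (fun b c => (b == c)%:R%:M) = \1%VF.
Proof.
move=> B0; apply/lfunP => X; rewrite !lfunE/= kraus_fun_id -rmorph_sum/= gibbs_sum1//.
by rewrite rmorph1 scale1r.
Qed.

Lemma block_thermal_id res : block_thermal res \1%VF.
Proof.
exists unit, (fun=> 0), (fun b c => (b == c)%:R%:M); split.
- by rewrite card_unit.
- exact: block_unitary_id.
- exact: block_energy_preserving_id.
- by move=> _ P [[] P1] _ [].
by rewrite gibbs_kraus_id ?card_unit.
Qed.

(** With one coordinate fixed, energy differences on the product are those of the other factor; an
    invariant set spreads first along [B1], then along [B2]. *)
Lemma resonant_energies_prod (B1 B2 : finType) (E1 : B1 -> R) (E2 : B2 -> R) :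
  resonant_energies E1 -> resonant_energies E2 ->
  resonant_energies (fun b : B1 * B2 => E1 b.1 + E2 b.2).
Proof.
move=> r1 r2 P [[a1 a2] Pa] Pcl [b1 b2].
apply: (r2 (fun b => P (b1, b))); last first.
  move=> b c bc; apply: Pcl => /=.
  by rewrite !rmorphD/= opprD addrACA subrr add0r.
exists a2; apply: (r1 (fun b => P (b, a2))); first by exists a1.
move=> b c bc; apply: Pcl => /=.
by rewrite !rmorphD/= opprD addrACA subrr addr0.
Qed.

Lemma gibbs_kraus_comp (B1 B2 : finType) (E1 : B1 -> R) (E2 : B2 -> R)
    (K1 : B1 -> B1 -> 'M[R[i]]_n) (K2 : B2 -> B2 -> 'M[R[i]]_n) :
  gibbs_kraus (fun b : B1 * B2 => E1 b.1 + E2 b.2) (block_comp K1 K2) =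
  (gibbs_kraus E1 K1 \o gibbs_kraus E2 K2)%VF.
Proof.
apply/lfunP => X; rewrite !lfunE/= !lfunE/= -kraus_fun_comp.
apply: eq_bigr => b _; apply: eq_bigr => c _ /=.
by rewrite gibbs_prod rmorphM.
Qed.

Lemma block_thermal_comp res f g :
  block_thermal res f -> block_thermal res g -> block_thermal res (f \o g)%VF.
Proof.
move=> [B1 [E1 [K1 [c1 u1 e1 r1 ->]]]] [B2 [E2 [K2 [c2 u2 e2 r2 ->]]]].
exists (B1 * B2)%type, (fun b => E1 b.1 + E2 b.2), (block_comp K1 K2); split.
- by rewrite card_prod muln_gt0 c1.
- exact: block_unitary_comp.
- move=> b c; rewrite (block_energy_preserving_comp e1 e2)/=.
  by rewrite !rmorphD.
- by move=> rt; apply: resonant_energies_prod; [exact: r1|exact: r2].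
by rewrite gibbs_kraus_comp.
Qed.

Hypothesis n_gt0 : (0 < n)%N.

Lemma ad_spectrum0 : ad_spectrum HS 0.
Proof.
have [a aP] := eigenvalue_closed HS n_gt0.
by exists a => //; exists a => //; rewrite subrr.
Qed.

Lemma ad_spectrumN x : ad_spectrum HS x -> ad_spectrum HS (- x).
Proof. by move=> [a aP [b bP <-]]; exists b => //; exists a => //; rewrite opprB. Qed.

Lemma resonant_energies_copies (B : finType) (E : B -> R) N :
  resonant_energies E -> resonant_energies (fun b : B * 'I_N => E b.1).
Proof.
move=> r P [[a j] Pa] Pcl [b l].
apply: (r (fun b => P (b, l))); last by move=> c d cd; apply: Pcl.
(* Two copies of a level differ by energy 0, which belongs to the spectrum of ad_HS. *)
by exists a; apply: Pcl Pa; rewrite /= subrr; exact: ad_spectrum0.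
Qed.

Lemma gibbs_kraus_mix (B : finType) (E : B -> R) N
    (K : 'I_N -> B -> B -> 'M[R[i]]_n) :
  gibbs_kraus (fun b : B * 'I_N => E b.1) (block_mix K) =
  N%:R^-1 *: \sum_j gibbs_kraus E (K j).
Proof.
apply/lfunP => X; rewrite scale_lfunE sum_lfunE lfunE/= scaler_sumr.
under [RHS]eq_bigr => j _ do rewrite lfunE/=.
rewrite -kraus_fun_mix.
apply: eq_bigr => b _; apply: eq_bigr => c _ /=.
by rewrite gibbs_copies rmorphM fmorphV rmorph_nat.
Qed.

Lemma block_thermal_mix res f g k N : (k <= N)%N -> (0 < N)%N ->
  block_thermal res f -> block_thermal res g ->
  block_thermal res (toC (k%:R / N%:R) *: f + (1 - toC (k%:R / N%:R)) *: g).
Proof.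
move=> kN N0 [B1 [E1 [K1 [c1 u1 e1 r1 ->]]]] [B2 [E2 [K2 [c2 u2 e2 r2 ->]]]].
pose id1 (b c : B1) : 'M[R[i]]_n := (b == c)%:R%:M.
pose id2 (b c : B2) : 'M[R[i]]_n := (b == c)%:R%:M.
pose E (b : B1 * B2) := E1 b.1 + E2 b.2.
(* On the common bath the first k register levels run f and leave [B2] idle; the others run g and
   leave [B1] idle. *)
pose K (j : 'I_N) := if (j < k)%N then block_comp K1 id2 else block_comp id1 K2.
have id1E : gibbs_kraus E1 id1 = \1%VF by exact: gibbs_kraus_id.
have id2E : gibbs_kraus E2 id2 = \1%VF by exact: gibbs_kraus_id.
exists (B1 * B2 * 'I_N)%type, (fun b => E b.1), (block_mix K); split.
- by rewrite !card_prod !muln_gt0 c1 c2 card_ord.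
- apply: block_unitary_mix => j; rewrite /K; case: ifP => _.
    by apply: block_unitary_comp => //; exact: block_unitary_id.
  by apply: block_unitary_comp => //; exact: block_unitary_id.
- apply: (@block_energy_preserving_mix _ _ _ _ K HS (toC \o E)) => j b c; rewrite /K.
  have h1 := block_energy_preserving_id HS (toC \o E1).
  have h2 := block_energy_preserving_id HS (toC \o E2).
  case: ifP => _.
    by rewrite (block_energy_preserving_comp e1 h2)/= !rmorphD.
  by rewrite (block_energy_preserving_comp h1 e2)/= !rmorphD.
- move=> rt; apply: resonant_energies_copies.
  by apply: resonant_energies_prod; [exact: r1|exact: r2].
rewrite gibbs_kraus_mix.
have -> : \sum_j gibbs_kraus E (K j) =
    \sum_(0 <= j < N) (if (j < k)%N then gibbs_kraus E1 K1 else gibbs_kraus E2 K2).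
  rewrite big_mkord; apply: eq_bigr => j _; rewrite /K; case: ifP => _.
    by rewrite gibbs_kraus_comp id2E comp_lfun1r.
  by rewrite gibbs_kraus_comp id1E comp_lfun1l.
rewrite (big_cat_nat (leq0n k) kN)/=.
have -> : \sum_(0 <= j < k) (if (j < k)%N then gibbs_kraus E1 K1 else gibbs_kraus E2 K2) =
    \sum_(0 <= j < k) gibbs_kraus E1 K1.
  by apply: eq_big_nat => j /andP[_ ->].
have -> : \sum_(k <= j < N) (if (j < k)%N then gibbs_kraus E1 K1 else gibbs_kraus E2 K2) =
    \sum_(k <= j < N) gibbs_kraus E2 K2.
  by apply: eq_big_nat => j /andP[kj _]; rewrite ltnNge kj.
have toCE : toC (k%:R / N%:R) = k%:R / N%:R.
  by rewrite [LHS]rmorphM/= [X in _ * X]fmorphV/= ![toC _%:R]rmorph_nat.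
by rewrite !sumr_const_nat subn0 toCE; exact/esym/rational_average.
Qed.

End block_thermal.

Lemma weighted_average (F : fieldType) (V : lmodType F) (a w : F) (x y : V) :
  a + w != 0 ->
  (a + w) *: ((a / (a + w)) *: y + (1 - a / (a + w)) *: x) = a *: y + w *: x.
Proof.
move=> aw0; rewrite scalerDr !scalerA mulrC divfK// mulrBr mulr1 [_ * (a / _)]mulrC.
by rewrite divfK// addrAC subrr add0r.
Qed.

(** * From rational to real weights and finite convex combinations *)

Section convexity.
Variables (R : realType) (n : nat).
Local Notation L := 'End('M[R[i]]_n).
Local Notation toC := (real_complex R).

Definition fractions : set R :=
  [set s | exists k N : nat, [/\ (k <= N)%N, (0 < N)%N & s = k%:R / N%:R]].

Lemma closure_fractions r : 0 <= r <= 1 -> closure fractions r.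
Proof.
move=> /andP[r0 r1] A /nbhs_ballP[e /= e0 eA].
(* A grid of mesh 1/N < e, with k/N the last grid point not above r. *)
pose N := (Num.truncn e^-1).+1; pose k := Num.truncn (r * N%:R).
have N0 : 0 < N%:R :> R by rewrite ltr0n.
have eN : e^-1 < N%:R.
  by have /andP[] := truncn_itv (ltW (divr_gt0 ltr01 e0)); rewrite mul1r.
have /andP[kle klt] := truncn_itv (mulr_ge0 r0 (ltW N0)).
exists (k%:R / N%:R); split.
  exists k, N; split => //.
  by rewrite -(ler_nat R); apply: le_trans kle _; rewrite ler_piMl// ltW.
apply: eA; rewrite /ball/= ger0_norm ?subr_ge0 ?ler_pdivrMr//.
rewrite -(ltr_pM2r N0) mulrBl divfK ?gt_eqF// ltrBlDr.
apply: lt_trans klt _; rewrite -natr1 addrC ltrD2r.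
by rewrite -ltr_pdivrMl// mulr1.
Qed.

(** Rational weights are dense in [0, 1] and the combination is continuous in the weight, which
    yields real weights in the closure. *)
Lemma fractions_convex (S : set L) :
  (forall f g k N, (k <= N)%N -> (0 < N)%N -> S f -> S g ->
     S (toC (k%:R / N%:R) *: f + (1 - toC (k%:R / N%:R)) *: g)) ->
  forall f g (r : R), closure S f -> closure S g -> 0 <= r <= 1 ->
     closure S (toC r *: f + (1 - toC r) *: g).
Proof.
move=> Smix; apply: closure_convex => f g r Sf Sg r01.
have hc : continuous (fun s : R => toC s *: f + (1 - toC s) *: g).
  move=> s; have sc : (fun s : R => toC s) @ s --> toC s.
    by apply: cvg_real_complex; exact: cvg_id.
  have sc' : (fun s : R => 1 - toC s) @ s --> 1 - toC s.
    exact: (cvgB (@cvg_cst _ (1 : R[i]) _ (nbhs s) _) sc).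
  exact: (cvg_lin_comb sc sc' (@cvg_cst_lfun _ _ _ (nbhs s) _ f)
    (@cvg_cst_lfun _ _ _ (nbhs s) _ g)).
apply: (closure_sub_preimage hc _ (closure_fractions r01)).
by move=> _ [k [N [kN N0 ->]]]; exact: Smix.
Qed.

Lemma convex_sum (S : set L) (I : finType) (w : I -> R) (x : I -> L) :
  (forall f g (r : R), S f -> S g -> 0 <= r <= 1 ->
     S (toC r *: f + (1 - toC r) *: g)) ->
  (forall j, 0 < w j) -> \sum_j w j = 1 -> (forall j, S (x j)) ->
  S (\sum_j toC (w j) *: x j).
Proof.
move=> Sconv w0 w1 Sx.
(* Absorbing one point at a time keeps the accumulated weight a positive. *)
have acc (s : seq I) a y : 0 < a -> S y ->
    S (toC (a + \sum_(j <- s) w j)^-1 *: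
       (toC a *: y + \sum_(j <- s) toC (w j) *: x j)).
  elim: s a y => [|j s IH] a y a0 Sy.
    by rewrite !big_nil !addr0 scalerA -rmorphM mulVf ?gt_eqF// rmorph1 scale1r.
  have aw : 0 < a + w j by rewrite addr_gt0.
  have aw0 : a + w j != 0 by rewrite gt_eqF.
  have E : toC (a + w j) *:
        (toC (a / (a + w j)) *: y + (1 - toC (a / (a + w j))) *: x j) =
      toC a *: y + toC (w j) *: x j.
    have tE : toC (a / (a + w j)) = toC a / (toC a + toC (w j)).
      by rewrite fmorph_div rmorphD.
    have tD : toC (a + w j) = toC a + toC (w j) by rewrite rmorphD.
    rewrite tE tD; apply: weighted_average; rewrite -tD.
    by apply/eqP => /complexI/eqP; exact/negP.
  rewrite !big_cons !addrA -E; apply: IH => //.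
  apply: Sconv => //.
  by apply/andP; split; [exact/ltW/divr_gt0|rewrite ler_pdivrMr// mul1r lerDl ltW].
have [j _|I0] := pickP (@predT I); last first.
  by move: w1; rewrite big_pred0// => /esym/eqP; rewrite oner_eq0.
(* Start from the point x j with its own weight and absorb the others; the total weight is 1. *)
have := acc [seq i <- index_enum I | i != j] (w j) (x j) (w0 j) (Sx j).
rewrite !big_filter => Sj; rewrite (bigD1 j)//=.
move: w1; rewrite (bigD1 j)//= => w1.
by rewrite w1 invr1 rmorph1 scale1r in Sj.
Qed.

End convexity.

Lemma hermitian_spectral_conj (C : numClosedFieldType) n (H : 'M[C]_n) :
  H \is hermsymmx -> exists (V : 'M[C]_n) (d : 'rV[C]_n), [/\ V \is unitarymx,
    H = V^t* *m diag_mx d *m V & forall i, d 0 i \is Num.real].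
Proof.
move=> Hh; exists (spectralmx H), (spectral_diag H); split.
- exact: spectral_unitarymx.
- rewrite -invmx_unitary ?spectral_unitarymx//.
  exact/orthomx_spectralP/hermitian_normalmx.
by move=> i; exact: (mxOverP (hermitian_spectral_diag_real Hh)).
Qed.

Lemma hermitian_spectral (R : realType) n (H : 'M[R[i]]_n) :
  H \is hermsymmx -> exists (V : 'M[R[i]]_n) (e : 'I_n -> R),
    V \is unitarymx /\ H = V^t* *m diag_mx (\row_i (e i)%:C%C) *m V.
Proof.
move=> /hermitian_spectral_conj[V [d [Vu -> d_real]]].
exists V, (fun i => complex.Re (d 0 i)); split; first exact: Vu.
by apply: eq_conj_diag => i; rewrite mxE RRe_real.
Qed.

(** * Decomposition into resonant operations *)

Section resonant_decomposition.
Variables (R : realType) (n : nat) (HS : 'M[R[i]]_n) (beta : R).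
Hypotheses (n_gt0 : (0 < n)%N) (HS_herm : HS \is hermsymmx).
Local Notation L := 'End('M[R[i]]_n).
Local Notation toC := (real_complex R).

Lemma closure_block_thermal_convex res f g (r : R) :
  closure (block_thermal HS beta res) f -> closure (block_thermal HS beta res) g ->
  0 <= r <= 1 ->
  closure (block_thermal HS beta res) (toC r *: f + (1 - toC r) *: g).
Proof.
apply: fractions_convex => {}f {}g k N kN N0 Sf Sg.
exact: block_thermal_mix.
Qed.

(** A nonzero block has a nonzero entry in the eigenbasis of [HS], and the two system eigenvalues at
    that entry realize the bath energy difference. *)
Lemma block_nonzero_ad (B : finType) (E : B -> R) (K : B -> B -> 'M[R[i]]_n) b c :
  block_energy_preserving HS (toC \o E) K -> K b c != 0 ->
  ad_spectrum HS (toC (E b) - toC (E c)).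
Proof.
move=> Ke Kbc; have [V [e [Vu HSE]]] := hermitian_spectral HS_herm.
have : V *m K b c *m V^t* != 0.
  by apply: contra_neq Kbc; exact: unitary_conj_eq0.
case/matrix0Pn => i [j Kij]; rewrite -opprB; apply: ad_spectrumN.
move: Ke; rewrite HSE => Ke.
rewrite -(block_entry_energy Vu Ke Kij).
exists (toC (e i)).
  by have := eigenvalue_conj_diag (\row_i toC (e i)) Vu i; rewrite mxE.
exists (toC (e j)).
  by have := eigenvalue_conj_diag (\row_i toC (e i)) Vu j; rewrite mxE.
by rewrite !mxE.
Qed.

Lemma block_thermal_decomposition f :
  block_thermal HS beta false f -> closure (block_thermal HS beta true) f.
Proof.
move=> [B [E [K [card_B Ku Ke _ ->]]]].
pose e : rel B := fun b c => `[< ad_spectrum HS (toC (E b) - toC (E c)) >].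
have e_sym : connect_sym e.
  by apply: sym_connect_sym => b c; apply/asboolP/asboolP => /ad_spectrumN; rewrite opprB.
pose D b0 : {pred B} := [pred c | connect e b0 c].
have D_eq b c : c \in D b -> D b =i D c.
  by move=> bc d; rewrite !inE; exact: (same_connect e_sym).
pose p := gibbs beta E; pose q b0 := \sum_(b in D b0) p b.
have q_gt0 b0 : 0 < q b0.
  rewrite /q (bigD1 b0)/= ?inE ?connect0// ltr_pwDl ?gibbs_gt0//.
  by apply: sumr_ge0 => c _; rewrite ltW// gibbs_gt0.
(* A nonzero block is an edge of the graph, so its two ends lie in the same component. *)
have K_block b0 b c : (b \in D b0) != (c \in D b0) -> K b c = 0.
  apply: contra_neq_eq => /(block_nonzero_ad Ke) /asboolP bc.
  by rewrite !inE; exact: (same_connect_r e_sym (connect1 bc)).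
(* Each component is used once per level b0 in it, with weight p b0; the
   weights of a component then add up to its probability q. *)
pose Phi b0 : L := gibbs_kraus beta (fun b : {x in D b0} => E (val b))
  (block_restr (D := D b0) K).
have -> : gibbs_kraus beta E K = \sum_b0 toC (p b0) *: Phi b0.
  apply/lfunP => X; rewrite sum_lfunE.
  pose t c := \sum_b toC (p c) *: (K b c *m X *m (K b c)^t*).
  have PhiE b0 : toC (q b0) *: Phi b0 X = \sum_(c in D b0) t c.
    have q0 : toC (q b0) != 0 by rewrite fmorph_eq0 gt_eqF.
    rewrite -(kraus_fun_restr (K_block b0) (toC \o p) X q0); congr (_ *: _).
    rewrite lfunE/=; apply: eq_bigr => b _; apply: eq_bigr => c _.
    by congr (_ *: _); rewrite /= gibbs_restr fmorph_div.
  transitivity (\sum_c t c); first by rewrite lfunE; exact: exchange_big.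
  transitivity (\sum_b0 \sum_(c in D b0) toC (p b0 / q b0) *: t c); last first.
    apply: eq_bigr => b0 _; rewrite -scaler_sumr -PhiE scalerA scale_lfunE.
    by rewrite -rmorphM divfK ?gt_eqF.
  rewrite [RHS](exchange_big_dep xpredT)//=; apply: eq_bigr => c _.
  transitivity ((\sum_(b0 | c \in D b0) toC (p b0 / q b0)) *: t c); last first.
    exact: scaler_suml.
  rewrite -rmorph_sum.
  (* As q is constant on a component, the ratios over the component of c sum to 1. *)
  suff -> : \sum_(b0 | c \in D b0) p b0 / q b0 = 1 by rewrite rmorph1 scale1r.
  transitivity (\sum_(b0 in D c) p b0 / q c); last first.
    by rewrite -mulr_suml -/(q c) divff// gt_eqF.
  apply: eq_big => [b0|b0 cb0]; first by rewrite !inE e_sym.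
  by congr (_ / _); apply: eq_bigl => d; exact: D_eq.
apply: convex_sum => [g h r||| b0].
- exact: closure_block_thermal_convex.
- by move=> b0; exact: gibbs_gt0.
- exact: gibbs_sum1.
apply: subset_closure.
exists {x in D b0}, (fun b => E (val b)), (block_restr K); split => //.
- by apply/card_gt0P; exists (exist _ b0 (connect0 e b0)).
- by apply: block_unitary_restr => // b c; exact: K_block.
- by move=> b c; exact: Ke.
move=> _ P [b1 Pb1] Pcl b.
(* An invariant set of levels of the component, seen among all bath levels, is closed under edges
   and hence contains the whole component. *)
pose Q c := [exists x : {x in D b0}, (val x == c) && P x].
have Qcl : fingraph.closed e Q.
  apply: (intro_closed e_sym) => c d cd /existsP[x /andP[/eqP xc Px]].
  have dD : d \in D b0.
    by rewrite (D_eq _ _ (valP x)) inE xc connect1.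
  apply/existsP; exists (exist _ d dD); rewrite eqxx/=.
  by apply: Pcl Px; rewrite /= xc; apply/asboolP.
have : Q (val b).
  have b1b : connect e (val b1) (val b).
    by have := valP b; rewrite (D_eq _ _ (valP b1)).
  have := closed_connect Qcl b1b; rewrite -!topredE/= => <-.
  by apply/existsP; exists b1; rewrite eqxx.
by move=> /existsP[x /andP[/eqP/val_inj <-]].
Qed.

End resonant_decomposition.

(* The value 0 at T = +oo makes the Gibbs weights uniform and e^(-HS/T) = 1. *)
Definition inv_temp (R : realType) (T : \bar R) : R :=
  if T is t%:E then t^-1 else 0.

(** * Boltzmann matrices and bath states in an eigenbasis *)

Section boltzmann.
Variables (R : realType) (T : \bar R).
Local Notation toC := (real_complex R).

Lemma boltzmann_spectral n (V : 'M[R[i]]_n) (e : 'I_n -> R) :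
  V \is unitarymx ->
  boltzmann T (V^t* *m diag_mx (\row_i toC (e i)) *m V) =
  V^t* *m diag_mx (\row_i toC (expR (- (inv_temp T * e i)))) *m V.
Proof.
move=> Vu.
(* This covers both infinite values of T: there [inv_temp] is 0 and every weight is 1. *)
have one : 1%:M = V^t* *m diag_mx (\row_i toC (expR (- (0 * e i)))) *m V.
  rewrite [X in diag_mx X](_ : _ = const_mx 1); last first.
    by apply/rowP => i; rewrite !mxE mul0r oppr0 expR0 rmorph1.
  by rewrite diag_const_mx mulmx1 unitary_mulCV.
case: T => [t||]; [|exact: one|exact: one].
rewrite /boltzmann /inv_temp scalemxAl scalemxAr.
have -> : - toC t^-1 *: diag_mx (\row_i toC (e i)) =
    diag_mx (\row_i toC (- (t^-1 * e i))).
  apply/matrixP => i j; rewrite !mxE mulrnAr; congr (_ *+ _).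
  by rewrite -rmorphN -rmorphM mulNr.
apply: expmx_conj_diag => // i; rewrite !mxE; exact: cvg_exp_series_real.
Qed.

Lemma boltzmann_diag m (E : 'I_m -> R) :
  boltzmann T (diag_mx (\row_i toC (E i))) =
  diag_mx (\row_i toC (expR (- (inv_temp T * E i)))).
Proof.
have u1 : (1%:M : 'M[R[i]]_m) \is unitarymx.
  by apply/unitarymxP; rewrite trmxC_scalar conjC1 mul1mx.
have := boltzmann_spectral E u1.
by rewrite trmxC_scalar conjC1 !mul1mx !mulmx1.
Qed.

Lemma bath_state_diag m (E : 'I_m -> R) :
  bath_state T (diag_mx (\row_i toC (E i))) =
  diag_mx (\row_i toC (gibbs (inv_temp T) E i)).
Proof.
have infinite : m%:R^-1 *: 1%:M = diag_mx (\row_i toC (gibbs 0 E i)).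
  rewrite -diag_const_mx; apply/matrixP => i j; rewrite !mxE mulrnAr mulr1.
  congr (_ *+ _); rewrite /gibbs; under eq_bigr do rewrite mul0r oppr0 expR0.
  rewrite mul0r oppr0 expR0 sumr_const card_ord mul1r.
  by rewrite fmorphV rmorph_nat.
case: T (boltzmann_diag E) infinite => [t||] //= -> _.
apply/matrixP => i j; rewrite !mxE mulrnAr; congr (_ *+ _).
rewrite mxtrace_diag; under eq_bigr do rewrite mxE.
by rewrite -rmorph_sum mulrC /gibbs [RHS]rmorphM [X in _ * X = _]/= -fmorphV.
Qed.

End boltzmann.

(** * Thermal operations as channels fixing the Boltzmann matrix *)

Section channel.
Variables (R : realType) (n : nat) (HS : 'M[R[i]]_n) (T : \bar R).
Hypotheses (HS_herm : HS \is hermsymmx).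
Local Notation L := 'End('M[R[i]]_n).
Local Notation toC := (real_complex R).
Local Notation TO := (block_thermal HS (inv_temp T) false).

Section gibbs_weights.
Variables (B : finType) (E : B -> R) (beta : R).

Lemma gibbs_toC_ge0 c : 0 <= toC (gibbs beta E c).
Proof. by rewrite ler0c ltW// gibbs_gt0. Qed.

Lemma gibbs_toC_sum1 : (0 < #|B|)%N -> \sum_c (toC \o gibbs beta E) c = 1.
Proof. by move=> B0; rewrite -rmorph_sum gibbs_sum1// rmorph1. Qed.
End gibbs_weights.

Lemma block_thermal_trace f : TO f -> trace_preserving f.
Proof.
move=> [B [E [K [B0 Ku _ _ ->]]]] X.
by rewrite lfunE/= kraus_fun_trace//; exact: gibbs_toC_sum1.
Qed.

Lemma block_thermal_le1 f i j k l : TO f -> `|f (delta_mx i j) k l| <= 1.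
Proof.
move=> [B [E [K [B0 Ku _ _ ->]]]]; rewrite lfunE/=.
apply: kraus_fun_delta_le1 => //; [exact: gibbs_toC_ge0|exact: gibbs_toC_sum1].
Qed.

Lemma block_thermal_boltzmann f : TO f -> f (boltzmann T HS) = boltzmann T HS.
Proof.
move=> [B [E [K [B0 Ku Ke _ ->]]]]; rewrite lfunE/=.
have [V [e [Vu HSE]]] := hermitian_spectral HS_herm.
rewrite HSE (boltzmann_spectral T e Vu) in Ke *.
set g := \row_i toC (expR _).
apply: kraus_fun_fixed => //; first exact: gibbs_toC_sum1.
move=> b c /=; apply/eqP; rewrite -subr_eq0; apply/eqP.
apply: (unitary_conj_eq0 Vu).
pose A := V *m K b c *m V^t*; pose Z := \sum_b expR (- (inv_temp T * E b)).
rewrite mulmxBr mulmxBl -!scalemxAr -!scalemxAl !mulmxA (unitarymxP Vu) mul1mx.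
rewrite (mulmxtVK _ Vu) -/A -[diag_mx g *m V *m _ *m _]mulmxA.
rewrite -[diag_mx g *m V *m _]mulmxA [V *m (K b c *m _)]mulmxA -/A.
have energy i j : A i j != 0 -> toC (e i) - toC (e j) = toC (E c) - toC (E b).
  by move=> /(block_entry_energy Vu Ke); rewrite !mxE.
move: (A) energy => {}A energy; apply/matrixP => i j.
rewrite mul_mx_diag mul_diag_mx !mxE.
have [->|Aij] := eqVneq (A i j) 0; first by rewrite !(mul0r, mulr0) subrr.
have := energy _ _ Aij; rewrite -!rmorphB => /complexI eE.
(* On a nonzero entry E_c + e_j = E_b + e_i, so the two products of Boltzmann factors agree. *)
suff gE : toC (gibbs (inv_temp T) E c) * toC (expR (- (inv_temp T * e j))) =
    toC (gibbs (inv_temp T) E b) * toC (expR (- (inv_temp T * e i))).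
  by rewrite mulrCA gE; ring.
rewrite -!rmorphM /gibbs; congr (toC _).
rewrite mulrAC -expRD [RHS]mulrAC -expRD; congr (expR _ / _).
have -> : E c = e i - e j + E b by rewrite eE subrK.
by ring.
Qed.

Lemma ampliation_kraus k (B : finType) (E : B -> R) beta
    (K : B -> B -> 'M[R[i]]_n) (P : 'M[R[i]]_(k * n)) :
  ampliation (gibbs_kraus beta E K) P = \sum_b \sum_c toC (gibbs beta E c) *:
    ((1%:M *t K b c) *m P *m (1%:M *t K b c)^t*).
Proof.
rewrite -(kraus_fun_ampliation (toC \o gibbs beta E)) /ampliation.
by apply: eq_bigr => i _; apply: eq_bigr => j _; rewrite lfunE.
Qed.

Lemma block_thermal_cp f : TO f -> completely_positive f.
Proof.
move=> [B [E [K [B0 Ku Ke _ ->]]]] k P Ppsd v.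
rewrite ampliation_kraus mulmx_sumr mulmx_suml summxE; apply: sumr_ge0 => b _.
rewrite mulmx_sumr mulmx_suml summxE; apply: sumr_ge0 => c _.
rewrite -scalemxAr -scalemxAl mxE mulr_ge0 ?gibbs_toC_ge0//.
set W := _ *t _.
(* The form of W P W^* at v is the form of P at W^* v. *)
have := Ppsd (W^t* *m v).
by rewrite trmxC_mul trmxCK !mulmxA.
Qed.

End channel.

(** * From unitaries on the composite system to blocks and back *)

Section bath_blocks.
Variables (C : numClosedFieldType) (n m : nat).
Implicit Types (A D U : 'M[C]_(n * m)) (H X : 'M[C]_n).

(** The system operator <b| A |c>. *)
Definition bath_block A (b c : 'I_m) : 'M[C]_n :=
  \matrix_(i, j) A (mxtens_index (i, b)) (mxtens_index (j, c)).

Lemma bath_block_inj A D :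
  (forall b c, bath_block A b c = bath_block D b c) -> A = D.
Proof.
move=> AD; apply/matrixP => q r; case: (mxtens_indexP q) => i b.
case: (mxtens_indexP r) => j c.
by have /matrixP/(_ i j) := AD b c; rewrite !mxE.
Qed.

Lemma bath_block_mul A D b c :
  bath_block (A *m D) b c = \sum_d bath_block A b d *m bath_block D d c.
Proof.
apply/matrixP => i j; rewrite summxE mxE mxE big_mxtens exchange_big.
apply: eq_bigr => d _; rewrite [RHS]mxE; apply: eq_bigr => k _.
by rewrite !mxE.
Qed.

Lemma bath_block_adj A b c : bath_block (A^t*) b c = (bath_block A c b)^t*.
Proof. by apply/matrixP => i j; rewrite !mxE. Qed.

Lemma bath_blockD A D b c :
  bath_block (A + D) b c = bath_block A b c + bath_block D b c.
Proof. by apply/matrixP => i j; rewrite !mxE. Qed.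

Lemma bath_block_tens X (Y : 'M[C]_m) b c :
  bath_block (X *t Y) b c = Y b c *: X.
Proof. by apply/matrixP => i j; rewrite mxE tensmxE mxE mulrC. Qed.

Lemma bath_block1 b c : bath_block 1%:M b c = (b == c)%:R%:M.
Proof.
apply/matrixP => i j; rewrite !mxE (can_eq (@mxtens_indexK n m)) xpair_eqE.
by rewrite andbC -mulnb natrM mulr_natr; case: (b == c).
Qed.

Lemma bath_block_tens_diag X (p : 'rV[C]_m) b c :
  bath_block (X *t diag_mx p) b c = (b == c)%:R *: (p 0 c *: X).
Proof.
rewrite bath_block_tens mxE; have [->|_] := eqVneq b c; first by rewrite scale1r.
by rewrite !scale0r.
Qed.

Lemma block_unitary_bath U : U \is unitarymx -> block_unitary (bath_block U).
Proof.
move=> Uu; split=> b c.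
  rewrite -bath_block1 -(unitary_mulCV Uu) bath_block_mul.
  by apply: eq_bigr => d _; rewrite bath_block_adj.
rewrite -bath_block1 -(unitarymxP Uu) bath_block_mul.
by apply: eq_bigr => d _; rewrite bath_block_adj.
Qed.

Lemma unitary_of_blocks U : block_unitary (bath_block U) -> U \is unitarymx.
Proof.
move=> Uu; apply/unitarymxP; apply: bath_block_inj => b c.
rewrite bath_block_mul bath_block1 -Uu.2.
by apply: eq_bigr => d _; rewrite bath_block_adj.
Qed.

(** The total energy is block diagonal with blocks H + E_c, so each product has a single term in
    every block. *)
Lemma commute_blocks U H (E : 'rV[C]_m) :
  U *m (H *t 1%:M + 1%:M *t diag_mx E) = (H *t 1%:M + 1%:M *t diag_mx E) *m U <->
  block_energy_preserving H (fun b => E 0 b) (bath_block U).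
Proof.
set G := _ + _.
have GE b c : bath_block G b c = (b == c)%:R *: (H + (E 0 c)%:M).
  rewrite bath_blockD bath_block_tens_diag bath_block_tens mxE -scalerDr.
  by rewrite scalemx1.
have UG b c : bath_block (U *m G) b c = bath_block U b c *m (H + (E 0 c)%:M).
  rewrite bath_block_mul (bigD1 c)//= GE eqxx scale1r big1 ?addr0// => d /negPf dc.
  by rewrite GE dc scale0r mulmx0.
have GU b c : bath_block (G *m U) b c = (H + (E 0 b)%:M) *m bath_block U b c.
  rewrite bath_block_mul (bigD1 b)//= GE eqxx scale1r big1 ?addr0// => d /negPf db.
  by rewrite GE eq_sym db scale0r mul0mx.
have key b c : bath_block (U *m G) b c = bath_block (G *m U) b c <->
    H *m bath_block U b c - bath_block U b c *m H = (E 0 c - E 0 b) *: bath_block U b c.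
  rewrite UG GU mulmxDr mulmxDl mul_mx_scalar mul_scalar_mx scalerBl.
  split=> [E1|/(canRL (subrK _)) ->].
    rewrite -[H *m _](addrK (E 0 b *: bath_block U b c)) -E1.
    by rewrite -[_ + _ - E 0 b *: _]addrA addrAC subrr add0r.
  by rewrite addrAC subrK addrC.
split=> [UGGU b c|Ke]; first by apply/key; rewrite UGGU.
by apply: bath_block_inj => b c; apply/key; exact: Ke.
Qed.

Lemma kraus_bath_block U (p : 'rV[C]_m) X :
  \sum_b bath_block (U *m (X *t diag_mx p) *m U^t*) b b =
  kraus_fun (fun c => p 0 c) (bath_block U) X.
Proof.
apply: eq_bigr => b _; rewrite bath_block_mul; apply: eq_bigr => c _.
rewrite bath_block_adj bath_block_mul (bigD1 c)//= bath_block_tens_diag eqxx scale1r.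
rewrite big1 ?addr0 => [|d /negPf dc]; first by rewrite -scalemxAr -scalemxAl.
by rewrite bath_block_tens_diag dc scale0r mulmx0.
Qed.

(** The partial trace is cyclic with respect to operators on the bath factor, which allows a change
    of bath basis. *)
Lemma sum_bath_block_conj (W : 'M[C]_m) A : W \is unitarymx ->
  \sum_b bath_block ((1%:M *t W^t*) *m A *m (1%:M *t W)) b b =
  \sum_b bath_block A b b.
Proof.
move=> Wu.
transitivity (\sum_b \sum_d \sum_c ((W^t*) b c * W d b) *: bath_block A c d).
  apply: eq_bigr => b _; rewrite bath_block_mul; apply: eq_bigr => d _.
  rewrite bath_block_tens bath_block_mul mulmx_suml; apply: eq_bigr => c _.
  by rewrite bath_block_tens -scalemxAl mul1mx -scalemxAr mulmx1 scalerA mulrC -scalerA.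
rewrite exchange_big; apply: eq_bigr => d _; rewrite exchange_big.
transitivity (\sum_c (W *m W^t*) d c *: bath_block A c d).
  apply: eq_bigr => c _; rewrite -scaler_suml mxE; congr (_ *: _).
  by apply: eq_bigr => b _; rewrite mulrC.
rewrite (unitarymxP Wu) (bigD1 d)//= mxE eqxx scale1r big1 ?addr0// => c /negPf cd.
by rewrite mxE eq_sym cd scale0r.
Qed.

Definition of_bath_blocks (K : 'I_m -> 'I_m -> 'M[C]_n) : 'M[C]_(n * m) :=
  \matrix_(q, r) K (mxtens_unindex q).2 (mxtens_unindex r).2
    (mxtens_unindex q).1 (mxtens_unindex r).1.

Lemma of_bath_blocksK K b c : bath_block (of_bath_blocks K) b c = K b c.
Proof. by apply/matrixP => i j; rewrite !mxE !mxtens_indexK. Qed.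

End bath_blocks.

(** * Unitaries commuting with a matrix *)

Section diagonal_calculus.
Variables (C : numClosedFieldType) (N : nat).
Implicit Types (V H : 'M[C]_N) (d e : 'rV[C]_N).

Lemma conj_diag_unitary V d : V \is unitarymx -> (forall i, `|d 0 i| = 1) ->
  V^t* *m diag_mx d *m V \is unitarymx.
Proof.
move=> Vu d1; apply: mul_unitarymx => //; apply: mul_unitarymx.
  by rewrite trmxC_unitary.
apply/unitarymxP/matrixP => i j; rewrite mul_diag_mx !mxE.
have [->|_] := eqVneq i j; first by rewrite -normCK d1 expr1n.
by rewrite !mulr0n conjC0 mulr0.
Qed.

(** Commuting with a diagonal matrix means having no entries between distinct eigenvalues. As [e] is
    constant where [d] is, the condition for [d] implies that for [e]: this is functional
    calculus. *)
Lemma conj_diag_commute V H d e : V \is unitarymx ->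
  (forall i j, d 0 i = d 0 j -> e 0 i = e 0 j) ->
  V^t* *m diag_mx d *m V *m H = H *m (V^t* *m diag_mx d *m V) ->
  V^t* *m diag_mx e *m V *m H = H *m (V^t* *m diag_mx e *m V).
Proof.
move=> Vu de.
have key f : V^t* *m diag_mx f *m V *m H = H *m (V^t* *m diag_mx f *m V) <->
    diag_mx f *m (V *m H *m V^t*) = V *m H *m V^t* *m diag_mx f.
  split=> [/(congr1 (fun A => V *m A *m V^t*))|/(congr1 (fun A => V^t* *m A *m V))].
    by rewrite !mulmxA (unitarymxP Vu) mul1mx (mulmxtVK _ Vu).
  rewrite !mulmxA (unitary_mulCV Vu) mul1mx => <-.
  by rewrite -[_ *m V^t* *m V]mulmxA (unitary_mulCV Vu) mulmx1.
move/key => dH; apply/key; apply/matrixP => i j.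
have /matrixP/(_ i j) := dH; move: (V *m H *m V^t*) => A.
rewrite !mul_diag_mx !mul_mx_diag !mxE mulrC => dA.
have [->|Aij] := eqVneq (A i j) 0; first by rewrite mulr0 mul0r.
by rewrite mulrC; congr (_ * _); apply: de; exact: (mulfI Aij).
Qed.

Lemma unitary_conj_commute U H : U \is unitarymx ->
  U *m H *m U^t* = H <-> U *m H = H *m U.
Proof.
move=> Uu; split=> [{2}<-|->]; last by rewrite (mulmxtVK _ Uu).
by rewrite -!mulmxA (unitary_mulCV Uu) mulmx1.
Qed.

Lemma unitary_spectral U : U \is unitarymx -> exists V d,
  [/\ V \is unitarymx, U = V^t* *m diag_mx d *m V & forall i, `|d 0 i| = 1].
Proof.
move=> Uu; have Un : U \is normalmx.
  by apply/normalmxP; rewrite (unitarymxP Uu) (unitary_mulCV Uu).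
pose V := spectralmx U; pose d := spectral_diag U.
have Vu : V \is unitarymx := spectral_unitarymx U.
have UE : U = V^t* *m diag_mx d *m V.
  by rewrite -(invmx_unitary Vu); exact/orthomx_spectralP.
exists V, d; split => // i.
have dE : diag_mx d = V *m U *m V^t*.
  by rewrite UE !mulmxA (unitarymxP Vu) mul1mx (mulmxtVK _ Vu).
have : diag_mx d \is unitarymx.
  by rewrite dE !mul_unitarymx// trmxC_unitary.
move=> /unitarymxP/matrixP/(_ i i); rewrite mul_diag_mx !mxE eqxx !mulr1n -normCK.
by move=> /eqP; rewrite sqrp_eq1// => /eqP.
Qed.

End diagonal_calculus.

Section unitary_exponential.
Variables (R : realType) (N : nat).
Local Notation toC := (real_complex R).

Definition cis (t : R) : R[i] := (cos t +i* sin t)%C.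

Lemma norm_cis t : `|cis t| = 1.
Proof.
by rewrite /cis normc_def/= cos2Dsin2 sqrtr1.
Qed.

Lemma cis0 : cis 0 = 1.
Proof. by rewrite /cis cos0 sin0. Qed.

Lemma unitary_angles (U : 'M[R[i]]_N) : U \is unitarymx ->
  exists V (th : 'I_N -> R), [/\ V \is unitarymx,
    U = V^t* *m diag_mx (\row_i cis (th i)) *m V &
    forall i j, cis (th i) = cis (th j) -> th i = th j].
Proof.
move=> /unitary_spectral[V [d [Vu UE d1]]].
(* The angle is a function of the eigenvalue, so that whatever commutes with U
   commutes with its logarithm. *)
pose arg (z : R[i]) := xget 0 [set t | z = cis t].
have argK i : cis (arg (d 0 i)) = d 0 i.
  apply/esym; rewrite /arg; case: xgetP => [t _ //|no].
  by have [t dt] := unimodular_cos_sin (d1 i); case: (no t).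
exists V, (fun i => arg (d 0 i)); split; first exact: Vu.
  by rewrite UE; apply: eq_conj_diag => i; rewrite mxE argK.
by move=> i j; rewrite !argK => ->.
Qed.

Lemma expmx_hermitian (V : 'M[R[i]]_N) (th : 'I_N -> R) : V \is unitarymx ->
  expmx ('i *: (V^t* *m diag_mx (\row_i toC (th i)) *m V)) =
  V^t* *m diag_mx (\row_i cis (th i)) *m V.
Proof.
move=> Vu; rewrite scalemxAl scalemxAr.
have -> : 'i *: diag_mx (\row_i toC (th i)) = diag_mx (\row_i ('i * toC (th i))).
  by apply/matrixP => i j; rewrite !mxE mulrnAr.
by apply: expmx_conj_diag => // i; rewrite !mxE; exact: cvg_exp_series_imag.
Qed.

Lemma conj_real_diag_hermitian (V : 'M[R[i]]_N) (th : 'I_N -> R) :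
  V^t* *m diag_mx (\row_i toC (th i)) *m V \is hermsymmx.
Proof.
apply/is_hermitianmxP; rewrite expr0 scale1r.
rewrite !trmxC_mul trmxCK mulmxA; congr (_ *m _ *m _).
apply/matrixP => i j; rewrite !mxE.
have [->|_] := eqVneq i j; last by rewrite !mulr0n conjC0.
by rewrite !mulr1n; apply/esym/CrealP; rewrite complex_real.
Qed.

Lemma unitary_hermitian_generator (U H : 'M[R[i]]_N) :
  U \is unitarymx -> U *m H = H *m U ->
  exists G : 'M[R[i]]_N,
    [/\ G \is hermsymmx, G *m H = H *m G & U = expmx ('i *: G)].
Proof.
move=> /unitary_angles[V [th [Vu -> thI]]] UH.
exists (V^t* *m diag_mx (\row_i toC (th i)) *m V); split.
- exact: conj_real_diag_hermitian.
- by apply: conj_diag_commute UH => // i j; rewrite !mxE => /thI ->.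
- by rewrite expmx_hermitian.
Qed.

Lemma hermitian_generator_unitary (G H : 'M[R[i]]_N) :
  G \is hermsymmx -> G *m H = H *m G ->
  expmx ('i *: G) \is unitarymx /\
  expmx ('i *: G) *m H = H *m expmx ('i *: G).
Proof.
move=> /hermitian_spectral[V [th [Vu ->]]] GH.
have -> := expmx_hermitian th Vu; split.
  by apply: conj_diag_unitary => // i; rewrite mxE norm_cis.
by apply: conj_diag_commute GH => // i j; rewrite !mxE => -[->].
Qed.

(** Scaling the angles by t gives the path exp(itG). The scaled angles are still functions of the
    eigenvalues of [U], so energy conservation holds at every t. *)
Lemma unitary_path (U H : 'M[R[i]]_N) :
  U \is unitarymx -> U *m H = H *m U ->
  exists W : R -> 'M[R[i]]_N,
    [/\ forall i j, continuous (fun t => W t i j), W 0 = 1%:M, W 1 = U &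
        forall t, W t \is unitarymx /\ W t *m H = H *m W t].
Proof.
move=> /unitary_angles[V [th [Vu -> thI]]] UH.
exists (fun t => V^t* *m diag_mx (\row_i cis (t * th i)) *m V); split.
- move=> i j t.
  have E s : (V^t* *m diag_mx (\row_i cis (s * th i)) *m V) i j =
      \sum_k (V^t*) i k * cis (s * th k) * V k j.
    by rewrite mxE; apply: eq_bigr => k _; rewrite mul_mx_diag [X in X * _ = _]mxE;
      congr (_ * _ * _); rewrite mxE.
  rewrite /continuous_at E (eq_cvg _ _ E); apply: cvg_sum => k.
  apply: cvgM; last exact: cvg_cst; apply: cvgM; first exact: cvg_cst.
  have mc : (fun s => s * th k) @ t --> t * th k.
    by apply: cvgM; [exact: cvg_id|exact: cvg_cst].
  by apply: cvg_complex; [apply: cvg_comp mc _; exact: continuous_cos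
                         |apply: cvg_comp mc _; exact: continuous_sin].
- rewrite [X in diag_mx X](_ : _ = const_mx 1); last first.
    by apply/rowP => i; rewrite !mxE mul0r cis0.
  by rewrite diag_const_mx mulmx1 unitary_mulCV.
- by apply: eq_conj_diag => i; rewrite !mxE mul1r.
move=> t; split; first by apply: conj_diag_unitary => // i; rewrite mxE norm_cis.
by apply: conj_diag_commute UH => // i j; rewrite !mxE => /thI ->.
Qed.

End unitary_exponential.

Lemma unitary_conj_sandwich (C : numClosedFieldType) N (Y U Z : 'M[C]_N) :
  Y \is unitarymx ->
  Y^t* *m ((Y *m U *m Y^t*) *m Z *m (Y *m U *m Y^t*)^t*) *m Y =
  U *m (Y^t* *m Z *m Y) *m U^t*.
Proof.
move=> Yu; rewrite !trmxC_mul trmxCK !mulmxA (unitary_mulCV Yu) mul1mx.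
by rewrite -[LHS]mulmxA (unitary_mulCV Yu) mulmx1.
Qed.

Lemma conj_unitary (C : numClosedFieldType) N (Y U : 'M[C]_N) :
  Y \is unitarymx -> U \is unitarymx -> Y *m U *m Y^t* \is unitarymx.
Proof. by move=> Yu Uu; rewrite !mul_unitarymx// trmxC_unitary. Qed.

Lemma unitary_conj_comm (C : numClosedFieldType) N (Y U H : 'M[C]_N) :
  Y \is unitarymx ->
  U *m (Y^t* *m H *m Y) = Y^t* *m H *m Y *m U ->
  (Y *m U *m Y^t*) *m H = H *m (Y *m U *m Y^t*).
Proof.
move=> Yu /(congr1 (fun A => Y *m A *m Y^t*)).
by rewrite !mulmxA (mulmxtVK _ Yu) (unitarymxP Yu) mul1mx.
Qed.

(** * Thermal maps in matrix form and in block form *)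

Section thermal_blocks.
Variables (R : realType) (n : nat) (HS : 'M[R[i]]_n) (T : \bar R).
Local Notation L := 'End('M[R[i]]_n).
Local Notation toC := (real_complex R).

Lemma ptraceBE m (A : 'M[R[i]]_(n * m)) : ptraceB A = \sum_b bath_block A b b.
Proof.
apply/matrixP => i j; rewrite summxE mxE; apply: eq_bigr => b _.
by rewrite mxE.
Qed.

Lemma thermal_map_diag m (E : 'I_m -> R) (U : 'M[R[i]]_(n * m)) :
  thermal_map T (diag_mx (\row_i toC (E i))) U =
  gibbs_kraus (inv_temp T) E (bath_block U).
Proof.
apply/lfunP => X; rewrite !lfunE/= /thermal_fun bath_state_diag ptraceBE.
rewrite kraus_bath_block; apply: eq_bigr => b _; apply: eq_bigr => c _.
by rewrite mxE.
Qed.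

Lemma bath_state_conj m (W : 'M[R[i]]_m) (E : 'I_m -> R) : W \is unitarymx ->
  bath_state T (W^t* *m diag_mx (\row_i toC (E i)) *m W) =
  W^t* *m bath_state T (diag_mx (\row_i toC (E i))) *m W.
Proof.
move=> Wu; have := boltzmann_spectral T E Wu; rewrite -boltzmann_diag.
case: T => [t||] /= Eb.
- by rewrite Eb mxtrace_mulC mulmxA (unitarymxP Wu) mul1mx -scalemxAr -scalemxAl.
- by rewrite -scalemxAr mulmx1 -scalemxAl unitary_mulCV.
- by rewrite -scalemxAr mulmx1 -scalemxAl unitary_mulCV.
Qed.

Lemma tens1_unitary m (W : 'M[R[i]]_m) :
  W \is unitarymx -> (1%:M : 'M[R[i]]_n) *t W \is unitarymx.
Proof.
move=> Wu; apply/unitarymxP; rewrite trmxC_tens tensmx_mul trmxC_scalar conjC1.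
rewrite mul1mx (unitarymxP Wu); apply: bath_block_inj => b c.
by rewrite bath_block1 bath_block_tens mxE scalemx1.
Qed.

(** The change of bath basis is absorbed into the unitary, so the bath Hamiltonian may be taken
    diagonal. *)
Lemma thermal_map_conj m (W : 'M[R[i]]_m) (E : 'I_m -> R)
    (U : 'M[R[i]]_(n * m)) : W \is unitarymx ->
  thermal_map T (W^t* *m diag_mx (\row_i toC (E i)) *m W) U =
  thermal_map T (diag_mx (\row_i toC (E i)))
    ((1%:M *t W) *m U *m (1%:M *t W)^t*).
Proof.
move=> Wu; apply/lfunP => X; rewrite !lfunE/= /thermal_fun bath_state_conj//.
set rho := bath_state _ _; set Y := 1%:M *t W.
have Yu : Y \is unitarymx by exact: tens1_unitary.
have YC : Y^t* = 1%:M *t (W^t*).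
  by rewrite trmxC_tens trmxC_scalar conjC1.
have -> : X *t (W^t* *m rho *m W) = Y^t* *m (X *t rho) *m Y.
  by rewrite YC !tensmx_mul mul1mx mulmx1.
rewrite !ptraceBE -[RHS](sum_bath_block_conj _ Wu) -YC -/Y.
apply: eq_bigr => b _; congr (bath_block _ b b).
exact/esym/unitary_conj_sandwich.
Qed.

Lemma total_energy_conj m (W : 'M[R[i]]_m) (D : 'M[R[i]]_m) : W \is unitarymx ->
  total_energy HS (W^t* *m D *m W) =
  (1%:M *t W)^t* *m total_energy HS D *m (1%:M *t W).
Proof.
move=> Wu; rewrite trmxC_tens trmxC_scalar conjC1 /total_energy mulmxDr mulmxDl.
by rewrite !tensmx_mul !mul1mx !mulmx1 unitary_mulCV.
Qed.

Definition unitary_commuting m (D : 'M[R[i]]_m) (U : 'M[R[i]]_(n * m)) : Prop :=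
  U \is unitarymx /\ U *m total_energy HS D = total_energy HS D *m U.

Lemma unitary_commuting_blocks m (E : 'I_m -> R) (U : 'M[R[i]]_(n * m)) :
  unitary_commuting (diag_mx (\row_i toC (E i))) U <->
  block_unitary (bath_block U) /\
  block_energy_preserving HS (toC \o E) (bath_block U).
Proof.
have EE : block_energy_preserving HS (fun b => (\row_i toC (E i)) 0 b) (bath_block U) <->
    block_energy_preserving HS (toC \o E) (bath_block U).
  by split=> Ke b c; have := Ke b c; rewrite !mxE.
split=> -[Uu UH]; split.
- exact: block_unitary_bath.
- by apply/EE/commute_blocks.
- exact: unitary_of_blocks.
by apply/commute_blocks/EE.
Qed.

Lemma hermitian_real_diag m (E : 'I_m -> R) :
  diag_mx (\row_i toC (E i)) \is hermsymmx.
Proof.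
have u1 : (1%:M : 'M[R[i]]_m) \is unitarymx.
  by apply/unitarymxP; rewrite trmxC_scalar conjC1 mul1mx.
have := conj_real_diag_hermitian (1%:M) E.
by rewrite trmxC_scalar conjC1 mul1mx mulmx1.
Qed.

Lemma thermal_operations_block :
  thermal_operations HS T `<=` block_thermal HS (inv_temp T) false.
Proof.
move=> Phi [m [HB [U [m0 HBh Uu UH ->]]]].
have [W [E [Wu HBE]]] := hermitian_spectral HBh; rewrite {}HBE in UH *.
rewrite thermal_map_conj//; set Y := 1%:M *t W; set U' := Y *m U *m Y^t*.
have Yu : Y \is unitarymx by exact: tens1_unitary.
have /unitary_commuting_blocks[Ku Ke] : unitary_commuting (diag_mx (\row_i toC (E i))) U'.
  split; first exact: conj_unitary.
  apply: (unitary_conj_comm Yu).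
  by move: UH => /(unitary_conj_commute _ Uu); rewrite (total_energy_conj _ Wu).
exists 'I_m, E, (bath_block U'); split => //; first by rewrite card_ord.
exact: thermal_map_diag.
Qed.

(** Listing the levels by increasing energy turns an abstract finite bath into an ordered diagonal
    Hamiltonian; blocks, Gibbs weights and resonance are transported along the enumeration. *)
Lemma block_thermal_sorted res Phi :
  block_thermal HS (inv_temp T) res Phi ->
  exists (m : nat) (E : 'I_m -> R) (U : 'M[R[i]]_(n * m)),
    [/\ (0 < m)%N, forall j k : 'I_m, (j <= k)%N -> E j <= E k,
        res -> resonant_energies HS E,
        unitary_commuting (diag_mx (\row_i toC (E i))) U &
        Phi = thermal_map T (diag_mx (\row_i toC (E i))) U].
Proof.
move=> [B [E [K [B0 [Kcol Krow] Ke Er ->]]]].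
pose le b c := E b <= E c.
have le_total : total le by move=> b c; exact: le_total.
have le_trans' : transitive le by move=> b c d; exact: le_trans.
pose s := sort le (enum B).
have s_size : size s == #|B| by rewrite size_sort -cardE.
pose phi (j : 'I_#|B|) := tnth (Tuple s_size) j.
have phi_inj : injective phi.
  by apply/tuple_uniqP; rewrite /= sort_uniq enum_uniq.
have phi_bij : bijective phi by apply: inj_card_bij => //; rewrite card_ord.
have [psi phiK psiK] := phi_bij.
have sum_phi (V : nmodType) (F : B -> V) : \sum_j F (phi j) = \sum_b F b.
  by rewrite [RHS](reindex phi)//; exact: onW_bij.
exists #|B|, (E \o phi), (of_bath_blocks (fun j k => K (phi j) (phi k))).
have KE j k : bath_block (of_bath_blocks (fun j k => K (phi j) (phi k))) j k =
   K (phi j) (phi k) by exact: of_bath_blocksK.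
split => //.
- move=> j k jk.
  have [b _] := card_gt0P B0.
  rewrite /= /phi !(tnth_nth b)/=.
  apply: (sorted_leq_nth le_trans' _ b (sort_sorted le_total _)) => //.
  + by move=> c; exact: lexx.
  + by rewrite inE (eqP s_size).
  + by rewrite inE (eqP s_size).
- move=> /Er {}Er P [j Pj] Pcl k; rewrite -[k]phiK.
  apply: (Er (P \o psi)); first by exists (phi j); rewrite /= phiK.
  by move=> b c bc; apply: Pcl; rewrite /= !psiK.
- apply/unitary_commuting_blocks; split.
    split=> j k; rewrite -(inj_eq phi_inj).
      by rewrite -Kcol -sum_phi; apply: eq_bigr => l _; rewrite !KE.
    by rewrite -Krow -sum_phi; apply: eq_bigr => l _; rewrite !KE.
  by move=> j k; rewrite KE; exact: Ke.
rewrite thermal_map_diag; apply/lfunP => X; rewrite !lfunE/=.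
rewrite /kraus_fun -sum_phi; apply: eq_bigr => j _.
rewrite -sum_phi; apply: eq_bigr => k _.
by rewrite KE /= /gibbs -sum_phi.
Qed.

Lemma block_thermal_operations :
  block_thermal HS (inv_temp T) false `<=` thermal_operations HS T.
Proof.
move=> Phi /block_thermal_sorted[m [E [U [m0 _ _ [Uu UH] ->]]]].
exists m, (diag_mx (\row_i toC (E i))), U; split => //.
- exact: hermitian_real_diag.
- exact/unitary_conj_commute.
Qed.

Lemma thermal_operationsE :
  thermal_operations HS T = block_thermal HS (inv_temp T) false.
Proof.
by apply/seteqP; split; [exact: thermal_operations_block|exact: block_thermal_operations].
Qed.

Lemma eigenvalue_diag m (d : 'rV[R[i]]_m) x :
  eigenvalue (diag_mx d) x <-> exists i, x = d 0 i.
Proof.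
split=> [/eigenvalueP[v vd v0]|[i ->]].
  have [i vi] : exists i, v 0 i != 0 by apply/rV0Pn.
  exists i; have /rowP/(_ i) := vd; rewrite mul_mx_diag !mxE [x * _]mulrC.
  by move=> /(mulfI vi).
apply/eigenvalueP; exists (delta_mx 0 i).
  apply/rowP => j; rewrite mul_mx_diag !mxE eqxx /=.
  by have [->|_] := eqVneq j i; rewrite ?mul1r ?mulr1 ?mul0r ?mulr0.
by apply/rV0Pn; exists i; rewrite mxE !eqxx oner_eq0.
Qed.

(** The levels whose energy is reachable by a path from that of level j form a nonempty invariant
    set, hence are all levels. *)
Lemma resonant_spectrum_diag m (E : 'I_m -> R) :
  resonant_energies HS E ->
  resonant_spectrum HS (diag_mx (\row_i toC (E i))).
Proof.
move=> Er x y /eigenvalue_diag[j ->] /eigenvalue_diag[k ->]; rewrite !mxE.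
pose P l := `[< exists2 p, path (resonance_edge HS (diag_mx (\row_i toC (E i))))
  (toC (E j)) p & last (toC (E j)) p = toC (E l) >].
apply/asboolP; apply: (Er P); first by exists j; apply/asboolP; exists [::].
move=> b c bc /asboolP[p pp lp]; apply/asboolP; exists (rcons p (toC (E c))).
  rewrite rcons_path pp lp /=; apply/and3P; split; last exact/asboolP.
    by apply/eigenvalue_diag; exists b; rewrite mxE.
  by apply/eigenvalue_diag; exists c; rewrite mxE.
by rewrite last_rcons.
Qed.

Lemma block_thermal_resonant :
  block_thermal HS (inv_temp T) true `<=` resonant_thermal_operations HS T.
Proof.
move=> Phi /block_thermal_sorted[m [E [U [m0 Es Er [Uu UH] ->]]]].
have [G [Gh GH ->]] := unitary_hermitian_generator Uu UH.
have EE : map_mx toC (\row_i E i) = \row_i toC (E i).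
  by apply/rowP => i; rewrite !mxE.
exists m, (\row_i E i), G; rewrite /= EE; split => //.
- by split => // j k jk; rewrite !mxE; exact: Es.
- exact/resonant_spectrum_diag/Er.
by rewrite GH subrr.
Qed.

Lemma resonant_sub_thermal :
  resonant_thermal_operations HS T `<=` thermal_operations HS T.
Proof.
move=> Phi [m [E [G [[m0 _] _ Gh /eqP + ->]]]]; rewrite subr_eq0 => /eqP GH.
have [Uu UH] := hermitian_generator_unitary Gh GH.
exists m, (diag_mx (map_mx toC E)), (expmx ('i *: G)); split => //.
  have -> : map_mx toC E = \row_i toC (E 0 i) by apply/rowP => i; rewrite !mxE.
  exact: hermitian_real_diag.
exact/unitary_conj_commute.
Qed.

End thermal_blocks.

(** * Closure and path-connectedness *)

Lemma continuous_sum (R : realType) (U : topologicalType) (J : Type)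
    (r : seq J) (f : J -> U -> R[i]) :
  (forall j, continuous (f j)) -> continuous (fun t => \sum_(j <- r) f j t).
Proof.
move=> fc t.
exact: (@cvg_sum R[i] R[i] U J (nbhs t) _ r f (f^~ t) (fun j => fc j t)).
Qed.

Lemma continuous_const (R : realType) (U : topologicalType) (z : R[i]) :
  continuous (fun _ : U => z).
Proof. by move=> t; exact: (@cvg_cst R[i] z U (nbhs t) _). Qed.

Lemma continuous_mul (R : realType) (U : topologicalType) (f g : U -> R[i]) :
  continuous f -> continuous g -> continuous (fun t => f t * g t).
Proof. by move=> fc gc t; exact: (cvgM (fc t) (gc t)). Qed.

Lemma closure_unit_disk (R : realType) (z : R[i]) :
  closure [set w : R[i] | `|w| <= 1] z -> `|z| <= 1.
Proof.
move=> clz; rewrite real_leNgt ?realE ?ler01 ?normr_ge0//; apply/negP => z1.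
(* The ball around z of radius |z| - 1 misses the unit disk. *)
have z1' : 0 < `|z| - 1 by rewrite subr_gt0.
have [w [/= w1 zw]] := clz _ (nbhsx_ballx z _ z1').
have := ler_normD w (z - w); rewrite addrC subrK.
move: zw; rewrite /ball/= => zw /le_lt_trans/(_ (ler_ltD w1 zw)).
by rewrite addrC subrK ltxx.
Qed.

Section closure_properties.
Variables (R : realType) (n : nat).
Local Notation L := 'End('M[R[i]]_n).

(** Points are closed, so equations for continuous functionals survive closure; trace preservation,
    the fixed point and positivity are all treated this way. *)
Lemma closure_sub_fiber (h : L -> R[i]) (S : set L) (z : R[i]) :
  continuous h -> (forall f, S f -> h f = z) ->
  forall f, closure S f -> h f = z.
Proof.
move=> hc hS f clf; have : closure [set z] (h f).
  by apply: (closure_sub_preimage hc) clf => g /hS.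
have z_closed : closed [set z].
  by apply: accessible_closed_set1; apply: hausdorff_accessible; exact: norm_hausdorff.
by rewrite -(iffLR (closure_id _) z_closed).
Qed.

Lemma closure_trace_preserving (S : set L) :
  (forall f, S f -> trace_preserving f) ->
  forall f, closure S f -> trace_preserving f.
Proof.
move=> St f clf X.
apply: (@closure_sub_fiber (fun g => \tr (g X)) S (\tr X)) clf.
  by apply: continuous_sum => i; exact: continuous_lfun_entry.
by move=> g /St; exact.
Qed.

Lemma closure_fixed (S : set L) (G : 'M[R[i]]_n) :
  (forall f, S f -> f G = G) -> forall f, closure S f -> f G = G.
Proof.
move=> SG f clf; apply/matrixP => i j.
apply: (@closure_sub_fiber (fun g => g G i j) S (G i j)) clf.
  exact: continuous_lfun_entry.
by move=> g /SG ->.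
Qed.

(** A finite linear combination of entries of values of [f] is continuous in [f]; the expansion
    serves to show this for the form. *)
Lemma ampliation_formE k (f : L) (P : 'M[R[i]]_(k * n)) (v : 'cV[R[i]]_(k * n)) :
  (v^t* *m ampliation f P *m v) 0 0 =
  \sum_i \sum_a \sum_j \sum_b (v (mxtens_index (j, b)) 0)^* *
    f (mxtens_block P j i) b a * v (mxtens_index (i, a)) 0.
Proof.
rewrite mxE big_mxtens; apply: eq_bigr => i _; apply: eq_bigr => a _.
rewrite mxE mulr_suml big_mxtens; apply: eq_bigr => j _; apply: eq_bigr => b _.
rewrite [ampliation _ _ _ _]delta_tens_sumE; congr (_ * _ * _).
by rewrite !mxE.
Qed.

Lemma closure_completely_positive (S : set L) :
  (forall f, S f -> completely_positive f) ->
  forall f, closure S f -> completely_positive f.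
Proof.
move=> Scp f clf k P Ppsd v.
pose h (g : L) : R[i] := (v^t* *m ampliation g P *m v) 0 0.
have hc : continuous h.
  have -> : h = (fun g => \sum_i \sum_a \sum_j \sum_b (v (mxtens_index (j, b)) 0)^* *
      g (mxtens_block P j i) b a * v (mxtens_index (i, a)) 0).
    by apply/funext => g; exact: ampliation_formE.
  do 4 (apply: continuous_sum => ?); apply: continuous_mul; last exact: continuous_const.
  by apply: continuous_mul; [exact: continuous_const|exact: continuous_lfun_entry].
(* Nonnegativity as an equation, which passes to the closure. *)
have h0 : `|h f| - h f = 0.
  apply: (@closure_sub_fiber (fun g => `|h g| - h g) S 0) clf => g.
    exact: (cvgB (cvg_norm (hc g)) (hc g)).
  by move=> /Scp/(_ k P Ppsd v) hg; rewrite ger0_norm ?subrr.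
by change (0 <= h f); rewrite -[h f](subKr `|h f|) h0 subr0.
Qed.

End closure_properties.

Section thermal_path.
Variables (R : realType) (n : nat) (HS : 'M[R[i]]_n) (T : \bar R).
Local Notation L := 'End('M[R[i]]_n).
Local Notation toC := (real_complex R).

Lemma cvg_conjC (I : Type) (F : set_system I) {FF : Filter F} (u : I -> R[i])
    (a : R[i]) : u @ F --> a -> (fun t => (u t)^*) @ F --> a^*.
Proof.
move=> /cvgrPdist_lt ua; apply/cvgrPdist_lt => e e0.
by apply: filterS (ua e e0) => t; rewrite -rmorphB norm_conjC.
Qed.

Lemma cvg_thermal_map m (D : 'M[R[i]]_m) (W : R -> 'M[R[i]]_(n * m)) :
  (forall p q, continuous (fun t => W t p q)) ->
  continuous (fun t => thermal_map T D (W t)).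
Proof.
move=> Wc t; apply/(@lfun_cvgP _ _ _ (nbhs t) (nbhs_filter t)) => X i j.
have E s : thermal_map T D (W s) X i j =
    \sum_k \sum_q \sum_r W s (mxtens_index (i, k)) r *
      (X *t bath_state T D) r q * (W s (mxtens_index (j, k)) q)^*.
  rewrite lfunE/= mxE; apply: eq_bigr => k _; rewrite mxE; apply: eq_bigr => q _.
  by rewrite mxE mulr_suml; apply: eq_bigr => r _; rewrite [(_ ^ _) q _]mxE [_^T q _]mxE.
rewrite E (eq_cvg _ _ E); move: t.
do 3 (apply: continuous_sum => ?); apply: continuous_mul; last first.
  by move=> t; exact: (cvg_conjC (Wc _ _ t)).
by apply: continuous_mul; [exact: Wc|exact: continuous_const].
Qed.

Lemma path_from_identity Phi : thermal_operations HS T Phi ->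
  exists gamma : R -> L, [/\ continuous gamma, gamma 0 = \1%VF, gamma 1 = Phi &
    forall t, thermal_operations HS T (gamma t)].
Proof.
rewrite {1}thermal_operationsE.
move=> /block_thermal_sorted[m [E [U [m0 _ _ [Uu UH] ->]]]].
have [W [Wc W0 W1 Wt]] := unitary_path Uu UH.
exists (fun t => thermal_map T (diag_mx (\row_i toC (E i))) (W t)); split.
- exact: cvg_thermal_map.
(* The blocks of the identity form the identity family, whose Kraus map is [\1] because the Gibbs
   weights sum to 1. *)
- rewrite W0 thermal_map_diag.
  transitivity (gibbs_kraus (inv_temp T) E (fun b c => (b == c)%:R%:M) : L).
    by congr gibbs_kraus; apply/funext => b; apply/funext => c; exact: bath_block1.
  by apply: gibbs_kraus_id; rewrite card_ord.
- by rewrite W1.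
move=> t; exists m, (diag_mx (\row_i toC (E i))), (W t).
have [Wu WH] := Wt t; split => //; first exact: hermitian_real_diag.
exact/unitary_conj_commute.
Qed.

Lemma thermal_semigroup : semigroup_with_id (thermal_operations HS T).
Proof.
rewrite thermal_operationsE; split; first exact: block_thermal_id.
by move=> f g; exact: block_thermal_comp.
Qed.

Lemma thermal_path_connected : path_connected R (thermal_operations HS T).
Proof.
move=> f g /path_from_identity[u [uc u0 u1 ut]] /path_from_identity[v [vc v0 v1 vt]].
(* Composing the two paths through the identity avoids a concatenation. *)
exists (fun t => (u (1 - t) \o v t)%VF); split.
- apply: continuous_subspaceT => t.
  have uc' : (fun s => u (1 - s)) @ t --> u (1 - t).
    have oc : (fun s : R => 1 - s) @ t --> 1 - t.
      exact: (cvgB (@cvg_cst _ (1 : R) _ (nbhs t) _) (@cvg_id _ (nbhs t))).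
    exact: (cvg_comp _ _ oc (uc (1 - t))).
  exact: (cvg_comp_lfun uc' (vc t)).
- by rewrite subr0 u1 v0 comp_lfun1r.
- by rewrite subrr u0 v1 comp_lfun1l.
by move=> t _; apply: thermal_semigroup.2.
Qed.

End thermal_path.

Theorem proposition4 (R : realType) (n : nat) (HS : 'M[R[i]]_n) (T : \bar R)
    (n_gt0 : (0 < n)%N) (HS_herm : HS \is hermsymmx) (T_gt0 : (0 < T)%E) :
  [/\ [/\ bounded_set (thermal_operations HS T),
          path_connected R (thermal_operations HS T) &
          semigroup_with_id (thermal_operations HS T)],
      [/\ convex_set (closure (thermal_operations HS T)),
          compact (closure (thermal_operations HS T)) &
          semigroup_with_id (closure (thermal_operations HS T))],
      closure (thermal_operations HS T) `<=`
        [set Phi : 'End('M[R[i]]_n) |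
          [/\ completely_positive Phi, trace_preserving Phi &
              Phi (boltzmann T HS) = boltzmann T HS]] &
      closure (thermal_operations HS T) =
        closure (resonant_thermal_operations HS T)].
Proof.
(* One bound on matrix units serves boundedness and, after passage to the closure, compactness. *)
have TO_le1 f i j k l : thermal_operations HS T f -> `|f (delta_mx i j) k l| <= 1.
  by rewrite thermal_operationsE; exact: block_thermal_le1.
split; [split|split| |].
- exact: bounded_set_lfun.
- exact: thermal_path_connected.
- exact: thermal_semigroup.
- apply: convex_set_real => f g r; rewrite thermal_operationsE.
  exact: closure_block_thermal_convex.
- apply: bounded_closed_compact_lfun; first exact: closed_closure.
  move=> f i j k l clf; apply: closure_unit_disk.
  have sub := @closure_sub_preimage _ _ (fun g : 'End('M[R[i]]_n) => g (delta_mx i j) k l)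
    (thermal_operations HS T) [set w : R[i] | `|w| <= 1].
  by apply: sub clf => [|g]; [exact: continuous_lfun_entry|exact: TO_le1].
- exact/closure_semigroup/thermal_semigroup.
- move=> f clf; split.
  + apply: closure_completely_positive clf => g.
    by rewrite thermal_operationsE; exact: block_thermal_cp.
  + apply: closure_trace_preserving clf => g.
    by rewrite thermal_operationsE; exact: block_thermal_trace.
  apply: closure_fixed clf => g.
  by rewrite thermal_operationsE; exact: block_thermal_boltzmann.
apply/seteqP; split; last exact/closureS/resonant_sub_thermal.
(* Closing twice changes nothing, so it suffices that each thermal operation lies in the closure of
   the resonant ones. *)
rewrite (iffLR (closure_id _) (@closed_closure _ (resonant_thermal_operations HS T))).
apply: closureS => f; rewrite thermal_operationsE => /block_thermal_decomposition clf.
by apply: (closureS (@block_thermal_resonant _ _ HS T)); exact: clf.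
Qed.
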